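(* Let $C\subset(-\pi,\pi)^{13}$ be the configuration space of the augmented square twist crease pattern. There are exactly four non-degenerate rigid folding modes of this crease pattern from the unfolded state; that is, exactly four of the curves of $C$ passing through the origin $0\in C$ are non-degenerate.
   Context: The augmented square twist is the following crease pattern in the plane (up to similarity), with 13 creases and 4 vertices. The vertices are $v_3=(-1,0)$, $v_2=(0,1)$, $v_4=(1,0)$, $v_1=(0,-1)$, the corners of the central square (diamond). The creases are: the four sides $v_1v_3$, $v_3v_2$, $v_2v_4$, $v_4v_1$ of the square; the diagonal $v_3v_4$ of the square; and eight creases running from the vertices outward to the edge of the paper (regarded as rays): from $v_3$ in directions $(0,1)$ and $(-1,0)$; from $v_2$ in directions $(0,1)$ and $(1,0)$; from $v_4$ in directions $(1,0)$ and $(0,-1)$; from $v_1$ in directions $(0,-1)$ and $(-1,0)$. Thus $v_1,v_2$ have degree 4 and $v_3,v_4$ have degree 5. The non-augmented square twist is the same pattern without the diagonal. The folding angle of the diagonal crease $v_3v_4$ is denoted $\zeta$. Rigid folding: each crease $c$ is assigned a folding angle $\rho_c$ (signed deviation of the dihedral angle from flat; one sign for valley, the other for mountain, $0$ for unfolded). For $\theta,\rho\in\mathbb{R}$ let $R(\theta,\rho)\in SO(3)$ be the rotation by angle $\rho$ about the axis $(\cos\theta,\sin\theta,0)$. An assignment of folding angles is a rigid folding state (all faces stay flat and rigid) if at every vertex $v$, with incident creases $c_1,\dots,c_k$ listed counterclockwise and leaving $v$ in directions with polar angles $\theta_1,\dots,\theta_k$, one has $R(\theta_1,\rho_{c_1})R(\theta_2,\rho_{c_2})\cdots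 R(\theta_k,\rho_{c_k})=I$. Self-intersection of the paper is not taken into account. The configuration space $C\subset(-\pi,\pi)^{13}$ is the set of all vectors $(\rho_c)_c$ of folding angles that are rigid folding states. The unfolded state is the origin. $C$ consists of a collection of curves. A rigid folding mode from the unfolded state is a curve of $C$ passing through the origin, i.e. the germ at the origin of a (real analytic) curve branch of $C$ through the origin; the two directions of travel along one branch count as the same mode. A mode is non-degenerate if all four vertices fold along it (at each vertex some incident folding angle is not identically zero along the curve) and $\zeta$ is not identically zero along it. *)

(* Defs.v *)
From Stdlib Require Import Reals Lra List Sorted.
From Coquelicot Require Import Coquelicot.
Import ListNotations.
Open Scope R_scope.

Inductive vertex := v1 | v2 | v3 | v4.

Inductive crease :=
  | side13 | side32 | side24 | side41 | diagonal
  | ray3N | ray3W | ray2N | ray2E | ray4E | ray4S | ray1S | ray1W.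

Definition position (v : vertex) : R * R :=
  match v with
  | v1 => (0, -1)
  | v2 => (0, 1)
  | v3 => (-1, 0)
  | v4 => (1, 0)
  end.

(* A crease is either the segment joining a vertex to another one ([inl]) or
   the ray from a vertex in a given direction ([inr]). *)
Definition geometry (c : crease) : vertex * (vertex + R * R) :=
  match c with
  | side13 => (v1, inl v3)
  | side32 => (v3, inl v2)
  | side24 => (v2, inl v4)
  | side41 => (v4, inl v1)
  | diagonal => (v3, inl v4)
  | ray3N => (v3, inr (0, 1))
  | ray3W => (v3, inr (-1, 0))
  | ray2N => (v2, inr (0, 1))
  | ray2E => (v2, inr (1, 0))
  | ray4E => (v4, inr (1, 0))
  | ray4S => (v4, inr (0, -1))
  | ray1S => (v1, inr (0, -1))
  | ray1W => (v1, inr (-1, 0))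
  end.

Definition displacement (p q : vertex) : R * R :=
  (fst (position q) - fst (position p), snd (position q) - snd (position p)).

Definition leaves (v : vertex) (c : crease) (d : R * R) : Prop :=
  match geometry c with
  | (p, inl q) =>
      (v = p /\ d = displacement p q) \/ (v = q /\ d = displacement q p)
  | (p, inr u) => v = p /\ d = u
  end.

(* The creases incident to a vertex in counterclockwise order, each with the
   polar angle of its direction away from the vertex.  The lemmas [fan_sound],
   [fan_complete] and [fan_counterclockwise] check the table against
   [geometry]. *)
Definition fan (v : vertex) : list (crease * R) :=
  match v with
  | v1 => [(side41, PI / 4); (side13, 3 * (PI / 4)); (ray1W, PI);
           (ray1S, 3 * (PI / 2))]
  | v2 => [(ray2E, 0); (ray2N, PI / 2); (side32, 5 * (PI / 4));
           (side24, 7 * (PI / 4))]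
  | v3 => [(diagonal, 0); (side32, PI / 4); (ray3N, PI / 2); (ray3W, PI);
           (side13, 7 * (PI / 4))]
  | v4 => [(ray4E, 0); (side24, 3 * (PI / 4)); (diagonal, PI);
           (side41, 5 * (PI / 4)); (ray4S, 3 * (PI / 2))]
  end.

Lemma fan_sound (v : vertex) (c : crease) (theta : R) :
  In (c, theta) (fan v) ->
  exists d r, leaves v c d /\ 0 < r /\ d = (r * cos theta, r * sin theta).
Proof.
assert (Hs : 0 < sqrt 2) by (apply sqrt_lt_R0; lra).
assert (Hss : sqrt 2 * / sqrt 2 = 1) by (apply Rinv_r; lra).
assert (c3 : cos (3 * (PI / 2)) = 0).
{ replace (3 * (PI / 2)) with (PI / 2 + PI) by field.
  rewrite neg_cos, cos_PI2; ring. }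
assert (s3 : sin (3 * (PI / 2)) = -1).
{ replace (3 * (PI / 2)) with (PI / 2 + PI) by field.
  rewrite neg_sin, sin_PI2; ring. }
assert (c5 : cos (5 * (PI / 4)) = - / sqrt 2).
{ replace (5 * (PI / 4)) with (PI / 4 + PI) by field.
  rewrite neg_cos, cos_PI4; field; lra. }
assert (s5 : sin (5 * (PI / 4)) = - / sqrt 2).
{ replace (5 * (PI / 4)) with (PI / 4 + PI) by field.
  rewrite neg_sin, sin_PI4; field; lra. }
assert (c7 : cos (7 * (PI / 4)) = / sqrt 2).
{ replace (7 * (PI / 4)) with (3 * (PI / 4) + PI) by field.
  rewrite neg_cos, cos_3PI4; field; lra. }
assert (s7 : sin (7 * (PI / 4)) = - / sqrt 2).
{ replace (7 * (PI / 4)) with (3 * (PI / 4) + PI) by field.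
  rewrite neg_sin, sin_3PI4; field; lra. }
destruct v; simpl; intros H;
repeat match goal with H : _ \/ _ |- _ => destruct H as [H | H] end;
try contradiction; injection H as <- <-;
rewrite ?cos_0, ?sin_0, ?cos_PI, ?sin_PI, ?cos_PI2, ?sin_PI2, ?cos_PI4,
  ?sin_PI4, ?cos_3PI4, ?sin_3PI4, ?c3, ?s3, ?c5, ?s5, ?c7, ?s7;
unfold leaves, displacement; simpl;
solve
  [ eexists; exists 1; split; [eauto | split; [lra | f_equal; simpl; lra]]
  | eexists; exists 2; split; [eauto | split; [lra | f_equal; simpl; lra]]
  | eexists; exists (sqrt 2); split;
    [eauto | split; [lra | f_equal; simpl; lra]] ].
Qed.

Lemma fan_complete (v : vertex) (c : crease) (d : R * R) :
  leaves v c d -> exists theta, In (c, theta) (fan v).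
Proof.
unfold leaves; destruct c; simpl; intros H;
repeat match goal with H : _ \/ _ |- _ => destruct H as [H | H] end;
destruct H as [-> _]; simpl; eauto 8.
Qed.

Lemma fan_counterclockwise (v : vertex) :
  StronglySorted Rlt (map snd (fan v)) /\
  List.Forall (fun theta => 0 <= theta < 2 * PI) (map snd (fan v)).
Proof.
assert (HPI := PI_RGT_0).
destruct v; simpl; split; repeat (constructor; try lra).
Qed.

(* Rodrigues' formula for the rotation by angle rho about the axis
   (cos theta, sin theta, 0). *)
Definition rotation (theta rho : R) : matrix (T := R) 3 3 :=
  let x := cos theta in
  let y := sin theta in
  let c := cos rho in
  let s := sin rho in
  mk_matrix 3 3 (fun i j =>
    match i, j with
    | 0%nat, 0%nat => c + x * x * (1 - c)
    | 0%nat, 1%nat => x * y * (1 - c)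
    | 0%nat, _ => y * s
    | 1%nat, 0%nat => x * y * (1 - c)
    | 1%nat, 1%nat => c + y * y * (1 - c)
    | 1%nat, _ => - (x * s)
    | _, 0%nat => - (y * s)
    | _, 1%nat => x * s
    | _, _ => c
    end).

(* A point of R^13: one folding angle for each crease. *)
Definition folding := crease -> R.

Definition holonomy (rho : folding) (v : vertex) : matrix (T := R) 3 3 :=
  fold_right
    (fun p M => Mmult (T := R_Ring) (rotation (snd p) (rho (fst p))) M)
    (Mone (T := R_Ring)) (fan v).

Definition rigid_folding_state (rho : folding) : Prop :=
  forall v, holonomy rho v = Mone (T := R_Ring).

Definition configuration_space (rho : folding) : Prop :=
  (forall c, - PI < rho c < PI) /\ rigid_folding_state rho.

Definition analytic_at_0 (f : R -> R) : Prop :=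
  exists a : nat -> R, locally 0 (fun t => is_pseries a t (f t)).

(* A curve branch through the origin is presented by a real analytic
   parametrization; only its germ at t = 0 is relevant.  Injectivity makes the
   image a whole branch, as opposed to a point or to one half of a branch
   traversed back and forth (as with t replaced by t^2); singular branches,
   such as cusps, are allowed. *)
Definition rigid_folding_mode (g : R -> folding) : Prop :=
  (forall c, g 0 c = 0) /\
  (forall c, analytic_at_0 (fun t => g t c)) /\
  (exists e, 0 < e /\
     forall s t, Rabs s < e -> Rabs t < e ->
       (forall c, g s c = g t c) -> s = t) /\
  locally 0 (fun t => configuration_space (g t)).

(* Inclusion of the germs at the origin of the images of two curves.  The
   image forgets the parametrization, in particular the direction of travel. *)
Definition germ_incl (g h : R -> folding) : Prop :=
  forall d, 0 < d -> exists e, 0 < e /\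
    forall s, Rabs s < e -> exists t, Rabs t < d /\ forall c, g s c = h t c.

Definition same_mode (g h : R -> folding) : Prop :=
  germ_incl g h /\ germ_incl h g.

Definition identically_zero (f : R -> R) : Prop :=
  locally 0 (fun t => f t = 0).

Definition folds_at (g : R -> folding) (v : vertex) : Prop :=
  exists c theta,
    In (c, theta) (fan v) /\ ~ identically_zero (fun t => g t c).

Definition non_degenerate (g : R -> folding) : Prop :=
  (forall v, folds_at g v) /\ ~ identically_zero (fun t => g t diagonal).

(* [P] holds of exactly [n] objects up to the relation [E]. *)
Definition exactly_up_to {T : Type} (E : T -> T -> Prop) (n : nat)
    (P : T -> Prop) : Prop :=
  exists f : nat -> T,
    (forall i, (i < n)%nat -> P (f i)) /\
    (forall i j, (i < n)%nat -> (j < n)%nat -> E (f i) (f j) -> i = j) /\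
    (forall x, P x -> exists i, (i < n)%nat /\ E x (f i)).

(* Main.v *)
Require Import Defs.
From Stdlib Require Import Reals Lra Arith Lia Psatz List.
From Coquelicot Require Import Coquelicot.
Import ListNotations.
Open Scope R_scope.

(* Write the rotation about a crease as the quaternion 1 + t e, where t is the
   tangent of half the folding angle; the condition at a vertex says that a
   product of such quaternions is a scalar.  With X, U, W, Y the half tangents of
   side32, side41, side24, side13 divided by sqrt 2 and z that of the diagonal,
   the degree 4 vertices give W = m X and Y = n U with m, n = 1 +- sqrt 2, and
   eliminating the two rays at each degree 5 vertex leaves F(X, Y, z) = 0 and
   F(U, W, z) = 0 for one polynomial F.  Near the origin and off z X U = 0, these
   two equations force U = X and z = - 2 X, for each of the four pairs (m, n), and
   then all half tangents are explicit functions of X.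
   An analytic curve could still change its pair (m, n) at the origin; it does
   not, because m is the ratio of two functions vanishing to the same order, and
   the two values of m have opposite signs.  Finally X is a continuous injective
   function of the parameter, so the curve covers the whole branch. *)

(** * Real analytic germs *)

Lemma locally_0_iff (P : R -> Prop) :
  locally 0 P <-> exists e, 0 < e /\ forall t, Rabs t < e -> P t.
Proof.
split.
- intros [e He]; exists e; split; [apply cond_pos |].
  intros t Ht; apply He; unfold ball; simpl; unfold AbsRing_ball; simpl.
  unfold abs, minus, plus, opp; simpl; now rewrite Ropp_0, Rplus_0_r.
- intros [e [He HP]]; exists (mkposreal e He); intros t Ht; apply HP.
  unfold ball in Ht; simpl in Ht; unfold AbsRing_ball in Ht; simpl in Ht.
  unfold abs, minus, plus, opp in Ht; simpl in Ht.
  now rewrite Ropp_0, Rplus_0_r in Ht.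
Qed.

Lemma continuity_pt_0_small (f : R -> R) (d : R) :
  continuity_pt f 0 -> f 0 = 0 -> 0 < d -> locally 0 (fun t => Rabs (f t) < d).
Proof.
intros Hf f0 Hd; apply locally_0_iff.
destruct (Hf d Hd) as [e [He H]]; exists e; split; [exact He |].
intros t Ht; destruct (Req_dec t 0) as [-> | Hne].
- now rewrite f0, Rabs_R0.
- specialize (H t); simpl in H; unfold Rdist in H.
  rewrite f0, !Rminus_0_r in H; apply H; repeat split; auto.
Qed.

Lemma analytic_scal (k : R) (f : R -> R) :
  analytic_at_0 f -> analytic_at_0 (fun t => k * f t).
Proof.
intros [a Ha]; exists (PS_scal k a); revert Ha; apply filter_imp; intros t Ht.
apply (is_pseries_scal (K := R_AbsRing) (V := R_NormedModule)); [| exact Ht].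
apply Rmult_comm.
Qed.

Lemma analytic_minus (f g : R -> R) :
  analytic_at_0 f -> analytic_at_0 g -> analytic_at_0 (fun t => f t - g t).
Proof.
intros [a Ha] [b Hb]; exists (PS_minus a b).
generalize (filter_and _ _ Ha Hb); apply filter_imp; intros t [Hf Hg].
now apply (is_pseries_minus (K := R_AbsRing) (V := R_NormedModule)).
Qed.

Lemma analytic_dilate (k : R) (f : R -> R) :
  analytic_at_0 f -> analytic_at_0 (fun t => f (k * t)).
Proof.
intros [a Ha]; exists (fun n => k ^ n * a n).
apply locally_0_iff in Ha; destruct Ha as [e [He Ha]].
(* The summand 1 keeps the denominator positive when [k] is 0. *)
apply locally_0_iff; exists (e / (Rabs k + 1)).
assert (Hk := Rabs_pos k).
split; [apply Rdiv_lt_0_compat; lra |]; intros t Ht.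
assert (Hkt : Rabs (k * t) < e).
{ rewrite Rabs_mult; apply Rmult_lt_compat_r with (r := Rabs k + 1) in Ht; [| lra].
  unfold Rdiv in Ht; rewrite Rmult_assoc, Rinv_l, Rmult_1_r in Ht by lra.
  assert (H := Rabs_pos t); nra. }
specialize (Ha _ Hkt); apply is_pseries_R in Ha; apply is_pseries_R.
revert Ha; apply is_series_ext; intros n; rewrite Rpow_mult_distr.
change (a n * (k ^ n * t ^ n) = k ^ n * a n * t ^ n); ring.
Qed.

(** The coefficients 1, 0, -1, 0, 1, ... of 1 / (1 + x^2), the derivative of the arctangent. *)
Fixpoint geom_coef (n : nat) : R :=
  match n with
  | O => 1
  | S O => 0
  | S (S m) => - geom_coef m
  end.

Lemma geom_coef_le (n : nat) : Rabs (geom_coef n) <= 1 /\ Rabs (geom_coef (S n)) <= 1.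
Proof.
induction n as [| n [IH1 IH2]].
- simpl; rewrite Rabs_R1, Rabs_R0; lra.
- split; [exact IH2 | simpl; now rewrite Rabs_Ropp].
Qed.

Lemma geom_radius (x : R) : Rabs x < 1 -> Rbar_lt (Rabs x) (CV_radius geom_coef).
Proof.
intros Hx; apply Rbar_lt_le_trans with 1; [exact Hx |].
apply CV_radius_bounded; exists 1; intros n.
rewrite pow1, Rmult_1_r; apply geom_coef_le.
Qed.

(** Dropping the first two coefficients negates the series, so its sum S satisfies S = 1 - x^2 S.
    The index 1 in [PSeries_decr_n] splits off exactly these two terms. *)
Lemma PSeries_geom_coef (x : R) : Rabs x < 1 -> PSeries geom_coef x = / (1 + x²).
Proof.
intros Hx.
assert (H := PSeries_decr_n geom_coef 1 x (CV_radius_inside _ _ (geom_radius x Hx))).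
rewrite (PSeries_ext (PS_decr_n geom_coef 2) (PS_opp geom_coef)) in H
  by (intros n; reflexivity).
rewrite PSeries_opp in H; simpl in H.
assert (0 <= x²) by apply Rle_0_sqr.
unfold Rsqr in *; apply Rmult_eq_reg_r with (1 + x * x); [| lra].
rewrite Rinv_l by lra; lra.
Qed.

(** The series of the derivative is integrated term by term from 0, on |t| < 1. *)
Lemma analytic_atan : analytic_at_0 atan.
Proof.
exists (PS_Int geom_coef); apply locally_0_iff; exists 1; split; [lra |].
intros t Ht.
assert (Hr := geom_radius t Ht).
enough (E : atan t = PSeries (PS_Int geom_coef) t).
{ rewrite E; apply PSeries_correct, CV_radius_inside.
  now rewrite CV_radius_Int. }
rewrite <- RInt_PSeries by exact Hr.
symmetry; apply is_RInt_unique.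
replace (atan t) with (minus (atan t) (atan 0))
  by (rewrite atan_0; unfold minus, plus, opp; simpl; ring).
assert (Hin : forall x, Rmin 0 t <= x <= Rmax 0 t -> Rabs x < 1).
{ intros x; unfold Rmin, Rmax; destruct (Rle_dec 0 t);
  revert Ht; unfold Rabs; destruct (Rcase_abs t), (Rcase_abs x); lra. }
apply (is_RInt_derive (V := R_CompleteNormedModule)).
- intros x Hx; rewrite PSeries_geom_coef by auto; apply is_derive_atan.
- intros x Hx; apply continuity_pt_filterlim, PSeries_continuity, geom_radius; auto.
Qed.

Lemma analytic_atan_linear (k : R) : analytic_at_0 (fun t => 2 * atan (k * t)).
Proof. apply analytic_scal, (analytic_dilate k atan), analytic_atan. Qed.

(** Convergence at e / 2 makes the terms there tend to 0, so the radius of convergence is at least e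
    / 2. *)
Lemma is_pseries_radius (f : R -> R) (a : nat -> R) :
  locally 0 (fun t => is_pseries a t (f t)) ->
  exists e, 0 < e /\ forall t, Rabs t < e ->
    f t = PSeries a t /\ Rbar_lt (Rabs t) (CV_radius a).
Proof.
intros Ha; apply locally_0_iff in Ha; destruct Ha as [e [He Ha]].
exists (e / 2); split; [lra |]; intros t Ht; split.
- symmetry; apply is_pseries_unique, Ha; lra.
- apply Rbar_lt_le_trans with (Rabs (e / 2)).
  + simpl; rewrite (Rabs_pos_eq (e / 2)) by lra; exact Ht.
  + apply Rbar_not_lt_le; intros Hc; apply (CV_disk_outside _ _ Hc).
    apply ex_series_lim_0; exists (f (e / 2)).
    apply is_pseries_R, Ha; rewrite Rabs_pos_eq; lra.
Qed.

Lemma analytic_continuity (f : R -> R) :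
  analytic_at_0 f ->
  exists e, 0 < e /\ forall t, Rabs t < e -> continuity_pt f t.
Proof.
intros [a Ha]; apply is_pseries_radius in Ha; destruct Ha as [e [He Ha]].
exists e; split; [exact He |]; intros t Ht.
apply continuity_pt_ext_loc with (PSeries a).
- assert (Hd : 0 < e - Rabs t) by lra.
  exists (mkposreal _ Hd); intros y Hy; symmetry; apply Ha.
  unfold ball in Hy; simpl in Hy; unfold AbsRing_ball in Hy; simpl in Hy.
  unfold abs, minus, plus, opp in Hy; simpl in Hy.
  assert (H := Rabs_triang (y + - t) t).
  replace (y + - t + t) with (y : R) in H by (simpl in y; lra); lra.
- apply PSeries_continuity, Ha, Ht.
Qed.

(** The limited principle of omniscience decides whether a nonzero term exists; strong induction
    then descends to the first one. *)
Lemma nat_zero_or_first_nonzero (a : nat -> R) :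
  (forall n, a n = 0) \/ exists n, a n <> 0 /\ forall k, (k < n)%nat -> a k = 0.
Proof.
destruct (LPO (fun n => a n <> 0)) as [[n Hn] | H].
- intros n; destruct (Req_EM_T (a n) 0); [right; tauto | left; auto].
- right; induction n as [n IH] using Wf_nat.lt_wf_ind.
  destruct (LPO (fun k => (k < n)%nat /\ a k <> 0)) as [[k [Hk Hak]] | H].
  + intros k; destruct (Compare_dec.lt_dec k n), (Req_EM_T (a k) 0); tauto.
  + apply (IH k Hk Hak).
  + exists n; split; [exact Hn |]; intros k Hk.
    destruct (Req_dec (a k) 0); [assumption | exfalso; apply (H k); auto].
- left; intros n; destruct (Req_dec (a n) 0); [assumption | now destruct (H n)].
Qed.

(** [n] is the index of the first nonzero coefficient and [phi] the series shifted by [n], whose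
    value at 0 is that coefficient. *)
Lemma analytic_factor (f : R -> R) :
  analytic_at_0 f ->
  identically_zero f \/
  exists (n : nat) (phi : R -> R), continuity_pt phi 0 /\ phi 0 <> 0 /\
    locally 0 (fun t => f t = t ^ n * phi t).
Proof.
intros [a Ha]; apply is_pseries_radius in Ha; destruct Ha as [e [He Ha]].
destruct (nat_zero_or_first_nonzero a) as [H | [n [Hn H]]].
- left; apply locally_0_iff; exists e; split; [exact He |]; intros t Ht.
  rewrite (proj1 (Ha t Ht)), (PSeries_ext a (fun _ => 0)) by exact H.
  apply PSeries_const_0.
- right; exists n, (PSeries (PS_decr_n a n)); repeat split.
  + apply PSeries_continuity.
    rewrite Rabs_R0; apply Rbar_lt_le_trans with (Rabs (e / 2)).
    * simpl; apply Rabs_pos_lt; lra.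
    * apply Rbar_not_lt_le; intros Hc; apply (CV_disk_outside _ _ Hc).
      apply ex_series_lim_0.
      (* At the nonzero point e / 2 a power of the variable can be divided out, so the shifted
         series still converges there and its radius is positive. *)
      assert (Hx : ex_pseries (PS_decr_n a n) (e / 2)).
      { apply (ex_pseries_decr_n (K := R_AbsRing) (V := R_NormedModule)).
        - right; exists (/ (e / 2)); unfold mult, one; simpl; field; lra.
        - apply CV_radius_inside, Ha; rewrite Rabs_pos_eq; lra. }
      destruct Hx as [l Hl]; exists l; now apply is_pseries_R.
  + rewrite PSeries_0; unfold PS_decr_n; now rewrite Nat.add_0_r.
  + apply locally_0_iff; exists e; split; [exact He |]; intros t Ht.
    rewrite (proj1 (Ha t Ht)); now apply PSeries_decr_n_aux.
Qed.

Lemma continuity_pt_away (phi : R -> R) (m : R) :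
  continuity_pt phi 0 -> m < phi 0 -> locally 0 (fun t => m < phi t).
Proof.
intros Hc Hm; apply locally_0_iff.
destruct (Hc (phi 0 - m)) as [e [He H]]; [lra |].
exists e; split; [exact He |]; intros t Ht.
destruct (Req_dec t 0) as [-> | Hne]; [exact Hm |].
specialize (H t); simpl in H; unfold Rdist in H; rewrite Rminus_0_r in H.
assert (Habs : Rabs (phi t - phi 0) < phi 0 - m) by (apply H; repeat split; auto).
apply Rabs_def2 in Habs; lra.
Qed.

Lemma continuity_pt_neq_0 (phi : R -> R) :
  continuity_pt phi 0 -> phi 0 <> 0 -> locally 0 (fun t => phi t <> 0).
Proof.
intros Hc H0.
assert (Hc2 := continuity_pt_mult _ _ _ Hc Hc).
generalize (continuity_pt_away _ 0 Hc2 ltac:(unfold mult_fct; nra)).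
apply filter_imp; unfold mult_fct; intros t Ht E; rewrite E in Ht; lra.
Qed.

Lemma analytic_isolated_zero (f : R -> R) :
  analytic_at_0 f -> ~ identically_zero f -> locally 0 (fun t => t <> 0 -> f t <> 0).
Proof.
intros Ha Hz; destruct (analytic_factor f Ha) as [H | (n & phi & Hc & H0 & E)].
{ contradiction. }
generalize (filter_and _ _ E (continuity_pt_neq_0 phi Hc H0)).
apply filter_imp; intros t [-> Hphi] Ht.
apply Rmult_integral_contrapositive_currified; [now apply pow_nonzero | exact Hphi].
Qed.

(** If p < q, dividing by t^p leaves |phi t| <= C |t^(k+1) psi t|, which fails for small t because
    phi 0 is nonzero. *)
Lemma monomial_comparison (p q : nat) (C : R) (phi psi : R -> R) :
  continuity_pt phi 0 -> phi 0 <> 0 -> continuity_pt psi 0 ->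
  locally 0 (fun t => Rabs (t ^ p * phi t) <= C * Rabs (t ^ q * psi t)) ->
  (q <= p)%nat.
Proof.
intros Hphi phi0 Hpsi HC.
destruct (Compare_dec.le_lt_dec q p) as [H | Hlt]; [exact H | exfalso].
assert (Hsub : exists k, q = (p + S k)%nat) by (exists (q - p - 1)%nat; lia).
destruct Hsub as [k ->].
(* The inequality is squared, so that the function compared with 0 is free of absolute values. *)
set (u := fun t => (phi t * phi t - C * C * (t ^ S k * t ^ S k) * (psi t * psi t))).
assert (Hu : continuity_pt u 0).
{ assert (Ht : continuity_pt (fun t : R => t ^ S k) 0).
  { apply derivable_continuous_pt, derivable_pt_pow. }
  unfold u; apply (continuity_pt_minus (fun t => phi t * phi t)).
  - now apply (continuity_pt_mult phi phi).
  - apply (continuity_pt_mult (fun t => C * C * (t ^ S k * t ^ S k))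
             (fun t => psi t * psi t)).
    + apply (continuity_pt_mult (fun _ => C * C) (fun t => t ^ S k * t ^ S k)).
      * apply continuity_pt_const; intros x y; reflexivity.
      * now apply (continuity_pt_mult (fun t => t ^ S k) (fun t => t ^ S k)).
    + now apply (continuity_pt_mult psi psi). }
assert (Hu0 : 0 < u 0) by (unfold u; simpl; nra).
generalize (filter_and _ _ (continuity_pt_away u 0 Hu Hu0) HC); intros H.
apply locally_0_iff in H; destruct H as [e [He H]].
destruct (H (e / 2)) as [H1 H2]; [rewrite Rabs_pos_eq; lra |].
set (t := e / 2) in *.
assert (Htp : 0 < t ^ p) by (apply pow_lt; unfold t; lra).
rewrite pow_add, !Rmult_assoc, !(Rabs_mult (t ^ p)) in H2.
rewrite (Rabs_pos_eq (t ^ p)) in H2 by lra.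
assert (H3 : Rabs (phi t) <= C * Rabs (t ^ S k * psi t)) by nra.
assert (H4 : Rabs (phi t) * Rabs (phi t) <=
  (C * Rabs (t ^ S k * psi t)) * (C * Rabs (t ^ S k * psi t))).
{ apply Rmult_le_compat; auto using Rabs_pos. }
replace ((C * Rabs (t ^ S k * psi t)) * (C * Rabs (t ^ S k * psi t)))
  with (C * C * (Rabs (t ^ S k * psi t) * Rabs (t ^ S k * psi t))) in H4 by ring.
rewrite <- !Rabs_mult, !Rabs_pos_eq in H4 by (apply Rle_0_sqr || nra).
unfold u in H1; nra.
Qed.

(* Comparable functions vanish to the same order, so their product has an even
   leading term. *)
Lemma analytic_product_sign (f h : R -> R) (C : R) :
  analytic_at_0 f -> analytic_at_0 h -> ~ identically_zero f ->
  ~ identically_zero h ->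
  locally 0 (fun t => Rabs (f t) <= C * Rabs (h t)) ->
  locally 0 (fun t => Rabs (h t) <= C * Rabs (f t)) ->
  locally 0 (fun t => t <> 0 -> 0 < f t * h t) \/
  locally 0 (fun t => t <> 0 -> f t * h t < 0).
Proof.
intros Hf Hh Hf0 Hh0 Hfh Hhf.
destruct (analytic_factor f Hf) as [? | (p & phi & Hphi & phi0 & Ef)]; [tauto |].
destruct (analytic_factor h Hh) as [? | (q & psi & Hpsi & psi0 & Eh)]; [tauto |].
assert (Epq : p = q).
{ apply Nat.le_antisymm.
  - apply (monomial_comparison q p C psi phi); auto.
    generalize (filter_and _ _ Hhf (filter_and _ _ Ef Eh)).
    apply filter_imp; intros t [H [E1 E2]]; now rewrite <- E1, <- E2.
  - apply (monomial_comparison p q C phi psi); auto.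
    generalize (filter_and _ _ Hfh (filter_and _ _ Ef Eh)).
    apply filter_imp; intros t [H [E1 E2]]; now rewrite <- E1, <- E2. }
subst q.
assert (Hsq : forall t, t <> 0 -> 0 < t ^ p * t ^ p).
{ intros t Ht; assert (H := pow_nonzero t p Ht); nra. }
assert (Hm := continuity_pt_mult _ _ _ Hphi Hpsi).
destruct (Rtotal_order (phi 0 * psi 0) 0) as [H | [H | H]].
- right; assert (Hm' := continuity_pt_opp _ _ Hm).
  generalize (filter_and _ _ (filter_and _ _ Ef Eh)
    (continuity_pt_away _ 0 Hm' ltac:(unfold opp_fct, mult_fct; lra))).
  apply filter_imp; unfold opp_fct, mult_fct; intros t [[-> ->] Ht] Hne.
  specialize (Hsq t Hne); nra.
- exfalso; apply Rmult_integral in H; tauto.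
- left.
  generalize (filter_and _ _ (filter_and _ _ Ef Eh)
    (continuity_pt_away _ 0 Hm ltac:(unfold mult_fct; lra))).
  apply filter_imp; unfold mult_fct; intros t [[-> ->] Ht] Hne.
  specialize (Hsq t Hne); nra.
Qed.

(** * Intermediate values and local surjectivity *)

Lemma IVT_between (f : R -> R) (a b y : R) :
  a < b -> (forall t, a <= t <= b -> continuity_pt f t) ->
  Rmin (f a) (f b) <= y <= Rmax (f a) (f b) ->
  exists t, a <= t <= b /\ f t = y.
Proof.
intros Hab Hf Hy.
destruct (Req_dec (f a) y) as [E | Ea]; [exists a; split; [lra | exact E] |].
destruct (Req_dec (f b) y) as [E | Eb]; [exists b; split; [lra | exact E] |].
assert (Hcst : forall t, continuity_pt (fun _ => y) t).
{ intros t; apply continuity_pt_const; intros u v; reflexivity. }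
revert Hy; unfold Rmin, Rmax; destruct (Rle_dec (f a) (f b)); intros Hy.
- destruct (Ranalysis5.IVT_interv (fun t => f t - y) a b) as [t [Ht E]]; try lra.
  + intros t Ht; apply continuity_pt_minus; auto.
  + exists t; split; [exact Ht | lra].
- destruct (Ranalysis5.IVT_interv (fun t => y - f t) a b) as [t [Ht E]]; try lra.
  + intros t Ht; apply continuity_pt_minus; auto.
  + exists t; split; [exact Ht | lra].
Qed.

(** By injectivity the values at b and -b have opposite signs, so every small y lies between them
    and is attained. *)
Lemma continuous_injective_open_at_0 (f : R -> R) (e : R) :
  0 < e -> (forall t, Rabs t < e -> continuity_pt f t) -> f 0 = 0 ->
  (forall s t, Rabs s < e -> Rabs t < e -> f s = f t -> s = t) ->
  exists d, 0 < d /\ forall y, Rabs y < d -> exists t, Rabs t < e /\ f t = y.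
Proof.
intros He Hf f0 Hinj.
set (b := e / 2).
assert (Hb : 0 < b < e) by (unfold b; lra).
assert (HA : forall t, - b <= t <= b -> Rabs t < e).
{ intros t Ht; apply Rabs_def1; lra. }
assert (Hp : f b <> 0).
{ intros E; enough (b = 0) by lra; apply Hinj; try apply HA; lra. }
assert (Hn : f (- b) <> 0).
{ intros E; enough (- b = 0) by lra; apply Hinj; try apply HA; lra. }
assert (Hopp : f b * f (- b) < 0).
{ destruct (Rlt_or_le (f b * f (- b)) 0) as [H | H]; [exact H | exfalso].
  assert (Hpos : 0 < f b * f (- b)) by nra; clear H.
  (* With equal signs, the value of smaller absolute value would be taken a second time on the other
     side of 0. *)
  destruct (Rle_dec (Rabs (f b)) (Rabs (f (- b)))) as [Hle | Hle].
  - destruct (IVT_between f (- b) 0 (f b)) as [t [Ht E]].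
    + lra.
    + intros t Ht; apply Hf, HA; lra.
    + rewrite f0; revert Hle; unfold Rmin, Rmax, Rabs.
      destruct (Rle_dec (f (- b)) 0), (Rcase_abs (f b)), (Rcase_abs (f (- b)));
        intros; split; nra.
    + enough (t = b) by lra; apply Hinj; try apply HA; lra.
  - destruct (IVT_between f 0 b (f (- b))) as [t [Ht E]].
    + lra.
    + intros t Ht; apply Hf, HA; lra.
    + rewrite f0; revert Hle; unfold Rmin, Rmax, Rabs.
      destruct (Rle_dec 0 (f b)), (Rcase_abs (f b)), (Rcase_abs (f (- b)));
        intros; split; nra.
    + enough (t = - b) by lra; apply Hinj; try apply HA; lra. }
exists (Rmin (Rabs (f b)) (Rabs (f (- b)))); split.
{ apply Rmin_pos; now apply Rabs_pos_lt. }
intros y Hy.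
destruct (IVT_between f (- b) b y) as [t [Ht E]].
- lra.
- intros t Ht; apply Hf, HA, Ht.
- assert (H1 := Rlt_le_trans _ _ _ Hy (Rmin_l _ _)).
  assert (H2 := Rlt_le_trans _ _ _ Hy (Rmin_r _ _)).
  clear Hy; revert H1 H2; unfold Rmin, Rmax, Rabs.
  destruct (Rle_dec (f (- b)) (f b)), (Rcase_abs (f b)), (Rcase_abs (f (- b))),
    (Rcase_abs y); intros; split; nra.
- exists t; split; [apply HA, Ht | exact E].
Qed.

(** * The polynomial system in the half tangents *)

Definition silver (m : R) : Prop := m * m = 2 * m + 1.

(* The conditions at a degree 4 vertex, for half tangents sqrt 2 * X and
   sqrt 2 * W on the sides and a, b on the rays opposite to them. *)
Definition degree4 (X W a b : R) : Prop :=
  a = X - W /\ b = X + W /\ W * W = X * X + 2 * X * W.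

(* The product (1 + Y (i - j)) (1 + z i) (1 + X (i + j)) over the inner creases
   of v3 has this real part; its imaginary coordinates are the right-hand sides
   in [degree5], up to the sign of the second.  It has to be proportional to the
   conjugate 1 + q i - p j - p q k of the product over the rays. *)
Definition real_part (X Y z : R) : R := 1 - z * (X + Y).
Definition degree5 (X Y z p q : R) : Prop :=
  q * real_part X Y z = X + Y + z - 2 * X * Y * z /\
  p * real_part X Y z = Y - X /\
  - (p * q) * real_part X Y z = z * (X + Y) + 2 * X * Y.

(* Eliminates p and q from [degree5]. *)
Definition quintic (X Y z : R) : R :=
  X * X - 2 * X * Y - Y * Y - 2 * z * Y + 4 * X * Y * Y * z +
  (X + Y) * (X + Y) * z * z.

(** With A the real part, (p A) (q A) = p q A^2: the first two right-hand sides multiply to - A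
    times the third. This relation is minus the quintic, and it holds even where A vanishes. *)
Lemma degree5_quintic (X Y z p q : R) : degree5 X Y z p q -> quintic X Y z = 0.
Proof.
unfold degree5, quintic, real_part; intros (H1 & H2 & H3).
set (A := 1 - z * (X + Y)) in *.
assert (E : (p * A) * (q * A) + A * (- (p * q) * A) = 0) by ring.
rewrite H1, H2, H3 in E; unfold A in E; nra.
Qed.

Lemma silver_roots (X W : R) :
  W * W = X * X + 2 * X * W ->
  exists m, silver m /\ W = m * X.
Proof.
unfold silver; intros H.
assert (H2 : sqrt 2 * sqrt 2 = 2) by (apply sqrt_sqrt; lra).
assert (E : (W - (1 + sqrt 2) * X) * (W - (1 - sqrt 2) * X) = 0).
{ replace ((W - (1 + sqrt 2) * X) * (W - (1 - sqrt 2) * X)) with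
    (W * W - 2 * X * W + (1 - sqrt 2 * sqrt 2) * (X * X)) by ring.
  rewrite H2; lra. }
apply Rmult_integral in E; destruct E as [E | E];
  [exists (1 + sqrt 2) | exists (1 - sqrt 2)]; split; nra.
Qed.

(** The roots are about -0.414 and 2.414; rational bounds on them feed the numerical estimates
    below. *)
Lemma silver_bounds (m : R) : silver m -> - 1 / 2 < m < 3 /\ 4 / 25 <= m * m.
Proof. unfold silver; intros H; repeat split; nra. Qed.

Lemma silver_two_roots (m n : R) :
  silver m -> silver n -> m = n \/ m + n = 2.
Proof.
unfold silver; intros Hm Hn.
assert (E : (m - n) * (m + n - 2) = 0) by nra.
apply Rmult_integral in E; destruct E; [left | right]; lra.
Qed.

(** The difference of the two equations is antisymmetric in X and U, hence X - U times a cofactor K.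
    The case U = X gives z = - 2 X; the case K = 0 has no small solution with z nonzero. *)
Lemma equal_ratios (n X U z : R) :
  silver n ->
  Rabs X < 1 / 100 -> Rabs U < 1 / 100 -> Rabs z < 1 / 100 ->
  X <> 0 -> z <> 0 ->
  quintic X (n * U) z = 0 -> quintic U (n * X) z = 0 ->
  X = U /\ z = - 2 * X.
Proof.
intros Hn HX HU Hz X0 z0 E1 E2.
apply Rabs_def2 in HX; apply Rabs_def2 in HU; apply Rabs_def2 in Hz.
destruct (silver_bounds n Hn) as [Hb Hb2]; unfold silver in Hn.
unfold quintic in *.
assert (HXX : 0 <= X * X <= 1 / 10000) by nra.
assert (HUU : 0 <= U * U <= 1 / 10000) by nra.
assert (Hzz : 0 < z * z <= 1 / 10000) by nra.
set (S := X + U).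
set (P := X * U).
assert (HP : - 1 / 10000 <= P <= 1 / 10000) by (unfold P; nra).
set (K := S * (2 * n + 2 - 2 * n * (z * z)) + 2 * n * z * (1 - 2 * n * P)).
assert (EK : (X - U) * K = 0).
{ unfold K, S, P.
  assert (E : forall k, k = n * n - 2 * n - 1 -> k = 0) by (intros; lra).
  specialize (E _ eq_refl).
  transitivity (
    (X * X - 2 * X * (n * U) - n * U * (n * U) - 2 * z * (n * U) +
      4 * X * (n * U) * (n * U) * z + (X + n * U) * (X + n * U) * z * z) -
    (U * U - 2 * U * (n * X) - n * X * (n * X) - 2 * z * (n * X) +
      4 * U * (n * X) * (n * X) * z + (U + n * X) * (U + n * X) * z * z) +
    (n * n - 2 * n - 1) * ((X * X - U * U) * (z * z - 1))); [ring |].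
  rewrite E1, E2, E; ring. }
apply Rmult_integral in EK; destruct EK as [EK | EK].
(* On the diagonal the quintic factors as - 2 n X (z + 2 X) (n X z - 1), modulo the equation of n,
   and the last factor is not 0 for small X and z. *)
- assert (U = X) by lra; subst U; split; [reflexivity |].
  assert (E : 2 * n * X * ((z + 2 * X) * (n * X * z - 1)) = 0).
  { transitivity ((X * X - 2 * X * (n * X) - n * X * (n * X) - 2 * z * (n * X) +
      4 * X * (n * X) * (n * X) * z + (X + n * X) * (X + n * X) * z * z) +
      (n * n - 2 * n - 1) * (X * X) * (1 + z * z)); [ring |].
    rewrite E1; rewrite Hn; ring. }
  apply Rmult_integral in E; destruct E as [E | E]; [exfalso; nra |].
  apply Rmult_integral in E; destruct E as [E | E]; [lra | exfalso].
  assert (n * X * z < 1); [| lra].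
  assert (- 1 / 10000 <= X * z <= 1 / 10000) by nra.
  nra.
- exfalso.
  (* The sum of the two equations, symmetric in X and U, is simplified with K = 0. *)
  assert (E : S * S * (1 + z * z) = 2 * P * (z * z)).
  { assert (E : 2 * S * S + 2 * (z * z) * (S * S) - 4 * P * (z * z) =
      (X * X - 2 * X * (n * U) - n * U * (n * U) - 2 * z * (n * U) +
      4 * X * (n * U) * (n * U) * z + (X + n * U) * (X + n * U) * z * z) +
      (U * U - 2 * U * (n * X) - n * X * (n * X) - 2 * z * (n * X) +
      4 * U * (n * X) * (n * X) * z + (U + n * X) * (U + n * X) * z * z) + S * K
      + (n * n - 2 * n - 1) * (S * S - 2 * P) * (1 - z * z)).
    { unfold K, S, P; ring. }
    rewrite E1, E2, EK, Hn in E; lra. }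
  set (L := n + 1 - n * (z * z)).
  assert (EL : S * L = - (n * z * (1 - 2 * n * P))).
  { unfold L; unfold K in EK; lra. }
  (* K = 0 expresses S L as a multiple of z. Substituted in the previous relation, it lets z^2
     cancel and leaves a left side of order P, at most 1/200, against a right side of at least
     12/100. *)
  assert (E' : z * z * (2 * P * (L * L)) =
               z * z * (n * n * ((1 - 2 * n * P) * (1 - 2 * n * P)) * (1 + z * z))).
  { transitivity (2 * P * (z * z) * (L * L)); [ring |]; rewrite <- E.
    transitivity ((S * L) * (S * L) * (1 + z * z)); [ring |]; rewrite EL; ring. }
  apply Rmult_eq_reg_l in E'; [| lra].
  assert (HL : 0 <= L * L <= 25) by (unfold L; split; nra).
  assert (HnP : - 1 / 1000 <= n * P <= 1 / 1000) by nra.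
  assert (Hsq : 81 / 100 <= (1 - 2 * n * P) * (1 - 2 * n * P)) by nra.
  assert (12 / 100 <= n * n * ((1 - 2 * n * P) * (1 - 2 * n * P))) by nra.
  nra.
Qed.

Lemma Rmult_sym_bound (a b A B : R) :
  - A <= a <= A -> - B <= b <= B -> - (A * B) <= a * b <= A * B.
Proof.
intros Ha Hb; apply Rabs_le in Ha, Hb.
assert (H : Rabs (a * b) <= A * B).
{ rewrite Rabs_mult; apply Rmult_le_compat; auto using Rabs_pos. }
revert H; unfold Rabs; destruct (Rcase_abs (a * b)); lra.
Qed.

(** This is the factor [B] in the proof of [opposite_ratios]. It is small because it has no constant
    term in X, U, z. *)
Lemma small_slope_factor (n X U z : R) :
  - 3 <= n <= 3 -> - (1 / 100) <= X <= 1 / 100 ->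
  - (1 / 100) <= U <= 1 / 100 -> - (1 / 100) <= z <= 1 / 100 ->
  Rabs (- 2 * n * X - n * n * (U + X) - n * z +
        2 * X * z * (n * n * (U + X) - X) + 2 * n * X * (z * z)) <= 1 / 2.
Proof.
intros Hn HX HU Hz.
assert (HnX := Rmult_sym_bound n X 3 (1 / 100) Hn HX).
assert (Hnz := Rmult_sym_bound n z 3 (1 / 100) Hn Hz).
assert (Hzz := Rmult_sym_bound _ _ _ _ Hz Hz).
assert (HXz := Rmult_sym_bound _ _ _ _ HX Hz).
assert (Hnn := Rmult_sym_bound n n 3 3 Hn Hn).
assert (HS : - (2 / 100) <= U + X <= 2 / 100) by lra.
assert (HnnS := Rmult_sym_bound _ _ _ _ Hnn HS).
assert (HT : - (1 / 5) <= n * n * (U + X) - X <= 1 / 5) by lra.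
assert (H1 := Rmult_sym_bound _ _ _ _ HXz HT).
assert (H2 := Rmult_sym_bound _ _ _ _ HnX Hzz).
apply Rabs_le; lra.
Qed.

(** The quantities h = U - X and w = z + 2 X measure the distance to the expected solution. The sum
    of the equations bounds |h| by a multiple of |w| X^2, the difference bounds |X w| by a multiple
    of |h|; for small X both h and w must vanish. *)
Lemma opposite_ratios (n X U z : R) :
  silver n ->
  Rabs X < 1 / 100 -> Rabs U < 1 / 100 -> Rabs z < 1 / 100 ->
  X <> 0 -> U <> 0 -> z <> 0 ->
  quintic X (n * U) z = 0 -> quintic U ((2 - n) * X) z = 0 ->
  X = U /\ z = - 2 * X.
Proof.
intros Hn HX HU Hz X0 U0 z0 E1 E2.
apply Rabs_def2 in HX; apply Rabs_def2 in HU; apply Rabs_def2 in Hz.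
destruct (silver_bounds n Hn) as [Hb Hb2]; unfold silver in Hn.
assert (HXX : 0 < X * X <= 1 / 10000) by nra.
assert (HUU : 0 < U * U <= 1 / 10000) by nra.
(* The two roots have product -1, so multiplying the second equation by n^2 rewrites it with n as
   the only root. *)
assert (En : (2 - n) * n = -1) by lra.
assert (E3 : n * n * quintic U ((2 - n) * X) z =
   n * n * (U * U) + 2 * n * X * U - X * X + 2 * n * z * X +
   4 * U * (X * X) * z + (n * U - X) * (n * U - X) * (z * z)).
{ unfold quintic.
  transitivity (n * n * (U * U) - 2 * ((2 - n) * n) * n * X * U
    - ((2 - n) * n) * ((2 - n) * n) * (X * X) - 2 * z * n * ((2 - n) * n) * X
    + 4 * U * ((2 - n) * n) * ((2 - n) * n) * (X * X) * z
    + (n * U + ((2 - n) * n) * X) * (n * U + ((2 - n) * n) * X) * (z * z)); [ring |].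
  rewrite En; ring. }
rewrite E2, Rmult_0_r in E3; symmetry in E3.
unfold quintic in E1.
set (h := U - X).
set (w := z + 2 * X).
(* The sum of the two equations is divisible by 2 z, and z is nonzero. *)
assert (EA : h * (n - 2 * (X * X)) = w * (X * X + n * n * (U * U))).
{ apply Rmult_eq_reg_l with (2 * z); [| lra].
  assert (E : 2 * z * (w * (X * X + n * n * (U * U)) - h * (n - 2 * (X * X))) =
   (X * X - 2 * X * (n * U) - n * U * (n * U) - 2 * z * (n * U) +
     4 * X * (n * U) * (n * U) * z + (X + n * U) * (X + n * U) * z * z) +
   (n * n * (U * U) + 2 * n * X * U - X * X + 2 * n * z * X +
   4 * U * (X * X) * z + (n * U - X) * (n * U - X) * (z * z))).
  { unfold h, w; ring. }
  rewrite E1, E3 in E; lra. }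
set (B := - 2 * n * X - n * n * (U + X) - n * z +
          2 * X * z * (n * n * (U + X) - X) + 2 * n * X * (z * z)).
(* This is half the difference of the two equations, modulo the equation of n. *)
assert (EB : 2 * n * X * w * (1 - X * z) = h * B).
{ assert (E : 2 * (h * B - 2 * n * X * w * (1 - X * z)) =
   (X * X - 2 * X * (n * U) - n * U * (n * U) - 2 * z * (n * U) +
     4 * X * (n * U) * (n * U) * z + (X + n * U) * (X + n * U) * z * z) -
   (n * n * (U * U) + 2 * n * X * U - X * X + 2 * n * z * X +
   4 * U * (X * X) * z + (n * U - X) * (n * U - X) * (z * z)) +
   (n * n - 2 * n - 1) * 2 * (X * X) * (1 - 2 * X * z)).
  { unfold B, h, w; ring. }
  rewrite E1, E3, Hn in E; lra. }
assert (HXa : 0 < Rabs X < 1 / 100).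
{ split; [now apply Rabs_pos_lt | apply Rabs_def1; lra]. }
assert (HUa : 0 < Rabs U < 1 / 100).
{ split; [now apply Rabs_pos_lt | apply Rabs_def1; lra]. }
assert (Hwa : 0 <= Rabs w <= 3 / 100).
{ split; [apply Rabs_pos | apply Rabs_le; unfold w; lra]. }
assert (HX2 : X * X = Rabs X * Rabs X) by (rewrite <- Rabs_mult, Rabs_pos_eq; lra).
assert (HU2 : U * U = Rabs U * Rabs U) by (rewrite <- Rabs_mult, Rabs_pos_eq; lra).
assert (Hn2 : n * n <= 9) by nra.
assert (Hna : 2 / 5 <= Rabs n <= 3) by (unfold Rabs; destruct (Rcase_abs n); nra).
assert (Hden : 39 / 100 <= Rabs (n - 2 * (X * X))).
{ assert (H := Rabs_triang_inv n (2 * (X * X))).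
  rewrite (Rabs_pos_eq (2 * (X * X))) in H by lra; lra. }
assert (Hh : 39 / 100 * Rabs h <= Rabs w * (X * X + 9 * (U * U))).
{ apply (f_equal Rabs) in EA; rewrite !Rabs_mult in EA.
  rewrite (Rabs_pos_eq (X * X + n * n * (U * U))) in EA by nra.
  assert (H := Rabs_pos h).
  apply Rle_trans with (Rabs h * Rabs (n - 2 * (X * X))); [nra |]; rewrite EA.
  apply Rmult_le_compat_l; nra. }
(* If U dominated X, then |h| would be at least |U| / 2, yet the previous bound makes it of order
   |w| U^2. *)
assert (HUX : Rabs U <= 2 * Rabs X).
{ destruct (Rle_or_lt (Rabs U) (2 * Rabs X)) as [H | H]; [exact H | exfalso].
  assert (Hhh : Rabs U / 2 <= Rabs h).
  { assert (H1 := Rabs_triang_inv U X); fold h in H1; lra. }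
  assert (Rabs w * (X * X + 9 * (U * U)) <= 3 / 100 * (10 * (Rabs U * Rabs U))).
  { apply Rmult_le_compat; nra. }
  nra. }
(* X^2 + 9 U^2 <= 37 X^2, and 37 divided by 39/100 is below 96. *)
assert (Hh2 : Rabs h <= 96 * (Rabs w * (Rabs X * Rabs X))).
{ assert (U * U <= 4 * (X * X)) by nra.
  assert (Rabs w * (X * X + 9 * (U * U)) <= Rabs w * (37 * (X * X))).
  { apply Rmult_le_compat_l; nra. }
  rewrite <- HX2; assert (0 <= Rabs w * (X * X)) by nra; lra. }
assert (HXz : - 1 / 10000 <= X * z <= 1 / 10000) by nra.
assert (HB : Rabs B <= 1 / 2).
{ apply small_slope_factor; lra. }
(* Otherwise 79/100 |X w| <= |h B| <= 48 |w| X^2 <= 48/100 |X w|. *)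
assert (Ew : w = 0).
{ destruct (Req_dec w 0) as [E | w0]; [exact E | exfalso].
  assert (Hw : 0 < Rabs w) by now apply Rabs_pos_lt.
  apply (f_equal Rabs) in EB; rewrite !Rabs_mult, (Rabs_pos_eq 2) in EB by lra.
  rewrite (Rabs_pos_eq (1 - X * z)) in EB by lra.
  assert (HXw : 0 < Rabs X * Rabs w) by now apply Rmult_lt_0_compat.
  assert (HRn : 79 / 100 <= 2 * Rabs n * (1 - X * z))
    by (clear - Hna HXz; nra).
  assert (H1 : 79 / 100 * (Rabs X * Rabs w) <=
    2 * Rabs n * (1 - X * z) * (Rabs X * Rabs w)).
  { apply Rmult_le_compat_r; lra. }
  assert (H2 : Rabs h * Rabs B <= 96 * (Rabs w * (Rabs X * Rabs X)) * (1 / 2)).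
  { apply Rmult_le_compat; auto using Rabs_pos. }
  assert (H3 : (Rabs X * Rabs w) * Rabs X <= (Rabs X * Rabs w) * (1 / 100)).
  { apply Rmult_le_compat_l; lra. }
  lra. }
assert (Eh : h = 0).
{ rewrite Ew, Rabs_R0, Rmult_0_l in Hh; assert (H := Rabs_pos h).
  destruct (Req_dec h 0) as [E | h0]; [exact E | exfalso].
  assert (0 < Rabs h) by (now apply Rabs_pos_lt); lra. }
unfold h, w in *; lra.
Qed.

Lemma small_solutions (X U W Y z : R) :
  Rabs X < 1 / 100 -> Rabs U < 1 / 100 -> Rabs z < 1 / 100 ->
  X <> 0 -> U <> 0 -> z <> 0 ->
  W * W = X * X + 2 * X * W -> Y * Y = U * U + 2 * U * Y ->
  quintic X Y z = 0 -> quintic U W z = 0 ->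
  U = X /\ z = - 2 * X.
Proof.
intros HX HU Hz X0 U0 z0 HW HY E1 E2.
destruct (silver_roots X W HW) as [m [Hm ->]].
destruct (silver_roots U Y HY) as [n [Hn ->]].
enough (X = U /\ z = - 2 * X) by (split; [symmetry |]; tauto).
destruct (silver_two_roots m n Hm Hn) as [-> | Hs].
- now apply (equal_ratios n).
- apply (opposite_ratios n); auto.
  now replace (2 - n) with m by lra.
Qed.

(** * Rotations as quaternions *)

Record quaternion := Quat { qr : R; qi : R; qj : R; qk : R }.

Definition qone : quaternion := Quat 1 0 0 0.

Definition qmul (p q : quaternion) : quaternion :=
  Quat (qr p * qr q - qi p * qi q - qj p * qj q - qk p * qk q)
       (qr p * qi q + qi p * qr q + qj p * qk q - qk p * qj q)
       (qr p * qj q - qi p * qk q + qj p * qr q + qk p * qi q)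
       (qr p * qk q + qi p * qj q - qj p * qi q + qk p * qr q).

Definition qscale (c : R) (q : quaternion) : quaternion :=
  Quat (c * qr q) (c * qi q) (c * qj q) (c * qk q).

Definition qnorm (q : quaternion) : R :=
  qr q * qr q + qi q * qi q + qj q * qj q + qk q * qk q.

Definition is_scalar (q : quaternion) : Prop := qi q = 0 /\ qj q = 0 /\ qk q = 0.

(* The matrix of v |-> q v q^*, which is a rotation when q is a unit. *)
Definition qmat (q : quaternion) : matrix (T := R) 3 3 :=
  let '(Quat a b c d) := q in
  mk_matrix 3 3 (fun i j =>
    match i, j with
    | 0%nat, 0%nat => a * a + b * b - c * c - d * d
    | 0%nat, 1%nat => 2 * (b * c - a * d)
    | 0%nat, _ => 2 * (b * d + a * c)
    | 1%nat, 0%nat => 2 * (b * c + a * d)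
    | 1%nat, 1%nat => a * a - b * b + c * c - d * d
    | 1%nat, _ => 2 * (c * d - a * b)
    | _, 0%nat => 2 * (b * d - a * c)
    | _, 1%nat => 2 * (c * d + a * b)
    | _, _ => a * a - b * b - c * c + d * d
    end).

Ltac entries :=
  apply mk_matrix_ext; intros [| [| [| i]]] [| [| [| j]]] Hi Hj; try lia.

Lemma qmat_mul (p q : quaternion) :
  Mmult (T := R_Ring) (qmat p) (qmat q) = qmat (qmul p q).
Proof.
destruct p as [a b c d], q as [a' b' c' d']; unfold qmul, Mmult; simpl qmat.
entries; simpl pred; rewrite !sum_Sn, sum_O; rewrite !coeff_mat_bij by lia;
unfold plus, mult; simpl; ring.
Qed.

(** Subtracting a diagonal entry from the unit norm leaves twice a sum of two squares of imaginary
    coordinates, which must be 0. *)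
Lemma qmat_scalar (q : quaternion) :
  qnorm q = 1 -> (qmat q = Mone (T := R_Ring) <-> is_scalar q).
Proof.
destruct q as [a b c d]; unfold qnorm, is_scalar, Mone; simpl; intros N; split.
- intros H.
  assert (H0 := proj2 (mk_matrix_ext 3 3 _ _) H 0%nat 0%nat ltac:(lia) ltac:(lia)).
  assert (H1 := proj2 (mk_matrix_ext 3 3 _ _) H 1%nat 1%nat ltac:(lia) ltac:(lia)).
  assert (H2 := proj2 (mk_matrix_ext 3 3 _ _) H 2%nat 2%nat ltac:(lia) ltac:(lia)).
  change (a * a + b * b - c * c - d * d = 1) in H0.
  change (a * a - b * b + c * c - d * d = 1) in H1.
  change (a * a - b * b - c * c + d * d = 1) in H2.
  repeat split; nra.
- intros (-> & -> & ->); entries; simpl;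
  first [transitivity 0; [ring | reflexivity] | transitivity 1; [lra | reflexivity]].
Qed.

Lemma qnorm_mul (p q : quaternion) : qnorm (qmul p q) = qnorm p * qnorm q.
Proof. destruct p, q; unfold qnorm; simpl; ring. Qed.

Lemma qmul_assoc (p q r : quaternion) : qmul p (qmul q r) = qmul (qmul p q) r.
Proof. destruct p, q, r; unfold qmul; simpl; f_equal; ring. Qed.

Lemma qmul_one_r (p : quaternion) : qmul p qone = p.
Proof. destruct p; unfold qmul; simpl; f_equal; ring. Qed.

Lemma qmul_scale (c d : R) (p q : quaternion) :
  qmul (qscale c p) (qscale d q) = qscale (c * d) (qmul p q).
Proof. destruct p, q; unfold qmul, qscale; simpl; f_equal; ring. Qed.

Lemma is_scalar_scale (c : R) (q : quaternion) :
  c <> 0 -> (is_scalar (qscale c q) <-> is_scalar q).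
Proof.
intros Hc; destruct q; unfold is_scalar, qscale; simpl; split; intros (H1 & H2 & H3).
- apply Rmult_integral in H1, H2, H3; tauto.
- rewrite H1, H2, H3; repeat split; ring.
Qed.

(* A product is a scalar exactly when the second factor is a multiple of the
   conjugate of the first. *)
Lemma is_scalar_mul (p q : quaternion) :
  qr p = 1 ->
  (is_scalar (qmul p q) <->
   qi q = - (qr q * qi p) /\ qj q = - (qr q * qj p) /\ qk q = - (qr q * qk p)).
Proof.
destruct p as [a b c d], q as [a' b' c' d']; unfold is_scalar; simpl; intros ->; split.
- intros (H1 & H2 & H3).
  (* N is the norm of the first factor. Multiplying the product by the conjugate of that factor
     recovers N times the second factor. *)
  set (N := 1 + b * b + c * c + d * d).
  assert (HN : N <> 0) by (unfold N; nra).
  set (r := 1 * a' - b * b' - c * c' - d * d').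
  set (s1 := 1 * b' + b * a' + c * d' - d * c') in *.
  set (s2 := 1 * c' - b * d' + c * a' + d * b') in *.
  set (s3 := 1 * d' + b * c' - c * b' + d * a') in *.
  assert (E0 : N * a' = r).
  { transitivity (r + b * s1 + c * s2 + d * s3);
    [unfold N, r, s1, s2, s3; ring | rewrite H1, H2, H3; ring]. }
  repeat split; apply Rmult_eq_reg_l with N; auto.
  + transitivity (- (r * b) + s1 - c * s3 + d * s2);
    [unfold N, r, s1, s2, s3; ring |]; rewrite H1, H2, H3, <- E0; ring.
  + transitivity (- (r * c) + s2 - d * s1 + b * s3);
    [unfold N, r, s1, s2, s3; ring |]; rewrite H1, H2, H3, <- E0; ring.
  + transitivity (- (r * d) + s3 - b * s2 + c * s1);
    [unfold N, r, s1, s2, s3; ring |]; rewrite H1, H2, H3, <- E0; ring.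
- intros (-> & -> & ->); repeat split; ring.
Qed.

Definition qconj (q : quaternion) : quaternion :=
  Quat (qr q) (- qi q) (- qj q) (- qk q).

Lemma qconj_mul (p q : quaternion) : qconj (qmul p q) = qmul (qconj q) (qconj p).
Proof. destruct p, q; unfold qconj, qmul; simpl; f_equal; ring. Qed.

Lemma is_scalar_conj (q : quaternion) : is_scalar (qconj q) <-> is_scalar q.
Proof. unfold is_scalar; simpl; lra. Qed.

(** If p q is a scalar, q is a multiple of the conjugate of p and so commutes with p. Conjugation,
    which reverses products, gives the converse. This permits cyclic shifts of the factors around a
    vertex. *)
Lemma is_scalar_mul_comm (p q : quaternion) :
  qr p = 1 -> (is_scalar (qmul p q) <-> is_scalar (qmul q p)).
Proof.
assert (Hcomm : forall p q, qr p = 1 -> is_scalar (qmul p q) -> is_scalar (qmul q p)).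
{ clear p q; intros p q Hp H; apply (is_scalar_mul p q Hp) in H; revert Hp H.
  destruct p as [a b c d], q as [a' b' c' d']; unfold is_scalar; simpl.
  intros -> (-> & -> & ->); repeat split; ring. }
intros Hp; split; [now apply Hcomm |]; intros H.
apply is_scalar_conj; rewrite qconj_mul; apply Hcomm; [exact Hp |].
now rewrite <- qconj_mul, is_scalar_conj.
Qed.

Definition half_angle_quat (theta rho : R) : quaternion :=
  Quat (cos (rho / 2)) (sin (rho / 2) * cos theta) (sin (rho / 2) * sin theta) 0.

Definition half_tan_quat (theta t : R) : quaternion :=
  Quat 1 (t * cos theta) (t * sin theta) 0.

Lemma qmat_rotation (theta rho : R) :
  rotation theta rho = qmat (half_angle_quat theta rho).
Proof.
unfold half_angle_quat, rotation, qmat.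
assert (Hc : cos rho = 1 - 2 * (sin (rho / 2) * sin (rho / 2))).
{  replace rho with (2 * (rho / 2)) at 1 by field; rewrite cos_2a_sin; ring. }
assert (Hs : sin rho = 2 * sin (rho / 2) * cos (rho / 2)).
{ rewrite <- sin_2a; f_equal; field. }
assert (H1 := sin2_cos2 (rho / 2)); assert (H2 := sin2_cos2 theta); unfold Rsqr in *.
rewrite Hc, Hs; revert H1 H2.
generalize (sin (rho / 2)) (cos (rho / 2)) (sin theta) (cos theta).
clear; intros s c y x H1 H2.
assert (E1 : c * c = 1 - s * s) by lra; assert (E2 : y * y = 1 - x * x) by lra.
entries.
- transitivity (c * c + s * s * (x * x) - s * s * (y * y)); [rewrite E1, E2 |]; ring.
- ring.
- ring.
- ring.
- transitivity (c * c - s * s * (x * x) + s * s * (y * y)); [|ring].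
  rewrite E1; transitivity (1 - 2 * (s * s) + (y * y) * (2 * s * s)); [ring |].
  rewrite E2; ring.
- ring.
- ring.
- ring.
- transitivity (c * c - s * s * (x * x) - s * s * (y * y)); [rewrite E1, E2 |]; ring.
Qed.

Lemma cos_half_neq_0 (rho : R) : - PI < rho < PI -> cos (rho / 2) <> 0.
Proof. intros H; apply Rgt_not_eq, cos_gt_0; lra. Qed.

Lemma half_angle_quat_scale (theta rho : R) :
  - PI < rho < PI ->
  half_angle_quat theta rho =
    qscale (cos (rho / 2)) (half_tan_quat theta (tan (rho / 2))).
Proof.
intros H; apply cos_half_neq_0 in H.
unfold half_angle_quat, qscale, half_tan_quat, tan; simpl; f_equal; field; auto.
Qed.

Lemma qnorm_half_angle_quat (theta rho : R) : qnorm (half_angle_quat theta rho) = 1.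
Proof.
unfold qnorm; simpl.
assert (H1 := sin2_cos2 (rho / 2)); assert (H2 := sin2_cos2 theta); unfold Rsqr in *.
transitivity (cos (rho / 2) * cos (rho / 2) + sin (rho / 2) * sin (rho / 2) *
  (sin theta * sin theta + cos theta * cos theta)); [ring |]; rewrite H2; lra.
Qed.

Definition half_tan (rho : folding) (c : crease) : R := tan (rho c / 2).

Definition half_tan_product (T : crease -> R) (l : list (crease * R)) : quaternion :=
  fold_right (fun p q => qmul (half_tan_quat (snd p) (T (fst p))) q) qone l.

(** The holonomy is the matrix of a product of unit quaternions. Each unit factor is cos (rho / 2)
    times its half tangent quaternion, and these cosines are nonzero for angles in (-PI, PI). *)
Lemma holonomy_scalar (rho : folding) (v : vertex) :
  (forall c, - PI < rho c < PI) ->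
  (holonomy rho v = Mone (T := R_Ring) <->
   is_scalar (half_tan_product (half_tan rho) (fan v))).
Proof.
intros Hrho; unfold holonomy.
set (Q := fold_right
  (fun p q => qmul (half_angle_quat (snd p) (rho (fst p))) q) qone (fan v)).
assert (E : fold_right
    (fun p M => Mmult (T := R_Ring) (rotation (snd p) (rho (fst p))) M)
    (Mone (T := R_Ring)) (fan v) = qmat Q /\ qnorm Q = 1 /\
  exists k, k <> 0 /\ Q = qscale k (half_tan_product (half_tan rho) (fan v))).
{ unfold Q, half_tan_product; induction (fan v) as [| [c theta] l IH]; simpl.
  - repeat split.
    + entries; simpl;
      first [transitivity 0; [reflexivity | ring] | transitivity 1; [reflexivity | ring]].
    + unfold qnorm; simpl; ring.
    + exists 1; split; [lra |]; unfold qscale; simpl; unfold qone; f_equal; ring.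
  - destruct IH as (E & N & k & Hk & EQ); repeat split.
    + etransitivity; [apply f_equal, E |].
      rewrite qmat_rotation; apply qmat_mul.
    + rewrite qnorm_mul, N, qnorm_half_angle_quat; ring.
    + exists (cos (rho c / 2) * k); split.
      * apply Rmult_integral_contrapositive_currified; auto using cos_half_neq_0.
      * now rewrite EQ, half_angle_quat_scale, qmul_scale. }
destruct E as (E & N & k & Hk & EQ).
transitivity (qmat Q = Mone (T := R_Ring)).
- split; intros H; [exact (eq_trans (eq_sym E) H) | exact (eq_trans E H)].
- rewrite (qmat_scalar Q N), EQ; now apply is_scalar_scale.
Qed.

(** * The vertex conditions *)

Lemma half_tan_quat_diag (x : R) :
  half_tan_quat (PI / 4) (sqrt 2 * x) = Quat 1 x x 0 /\
  half_tan_quat (3 * (PI / 4)) (sqrt 2 * x) = Quat 1 (- x) x 0 /\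
  half_tan_quat (5 * (PI / 4)) (sqrt 2 * x) = Quat 1 (- x) (- x) 0 /\
  half_tan_quat (7 * (PI / 4)) (sqrt 2 * x) = Quat 1 x (- x) 0.
Proof.
assert (Hs : 0 < sqrt 2) by (apply sqrt_lt_R0; lra).
unfold half_tan_quat.
replace (5 * (PI / 4)) with (PI / 4 + PI) by field.
replace (7 * (PI / 4)) with (3 * (PI / 4) + PI) by field.
rewrite !neg_cos, !neg_sin, cos_PI4, sin_PI4, cos_3PI4, sin_3PI4.
repeat split; f_equal; field; lra.
Qed.

Lemma half_tan_quat_axis (t : R) :
  half_tan_quat 0 t = Quat 1 t 0 0 /\
  half_tan_quat (PI / 2) t = Quat 1 0 t 0 /\
  half_tan_quat PI t = Quat 1 (- t) 0 0 /\
  half_tan_quat (3 * (PI / 2)) t = Quat 1 0 (- t) 0.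
Proof.
unfold half_tan_quat.
replace (3 * (PI / 2)) with (PI / 2 + PI) by field.
rewrite neg_cos, neg_sin, cos_0, sin_0, cos_PI2, sin_PI2, cos_PI, sin_PI.
repeat split; f_equal; ring.
Qed.

(** The factor sqrt 2 clears the coordinates of the diagonal directions. The bracketing separates
    rays from inner creases as the four vertex lemmas below expect. *)
Lemma half_tan_product_fan (T : crease -> R) (X U W Y : R) :
  T side32 = sqrt 2 * X -> T side41 = sqrt 2 * U ->
  T side24 = sqrt 2 * W -> T side13 = sqrt 2 * Y ->
  half_tan_product T (fan v1) =
    qmul (qmul (Quat 1 U U 0) (Quat 1 (- Y) Y 0))
         (qmul (Quat 1 (- T ray1W) 0 0) (Quat 1 0 (- T ray1S) 0)) /\
  half_tan_product T (fan v2) =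
    qmul (qmul (Quat 1 (T ray2E) 0 0) (Quat 1 0 (T ray2N) 0))
         (qmul (Quat 1 (- X) (- X) 0) (Quat 1 W (- W) 0)) /\
  half_tan_product T (fan v3) =
    qmul (qmul (Quat 1 (T diagonal) 0 0) (Quat 1 X X 0))
         (qmul (qmul (Quat 1 0 (T ray3N) 0) (Quat 1 (- T ray3W) 0 0))
               (Quat 1 Y (- Y) 0)) /\
  half_tan_product T (fan v4) =
    qmul (qmul (Quat 1 (T ray4E) 0 0)
           (qmul (qmul (Quat 1 (- W) W 0) (Quat 1 (- T diagonal) 0 0))
                 (Quat 1 (- U) (- U) 0)))
         (Quat 1 0 (- T ray4S) 0).
Proof.
intros EX EU EW EY; unfold half_tan_product; simpl.
destruct (half_tan_quat_diag X) as (X1 & X2 & X3 & X4).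
destruct (half_tan_quat_diag U) as (U1 & U2 & U3 & U4).
destruct (half_tan_quat_diag W) as (W1 & W2 & W3 & W4).
destruct (half_tan_quat_diag Y) as (Y1 & Y2 & Y3 & Y4).
rewrite !EX, !EU, !EW, !EY, ?X1, ?X2, ?X3, ?X4, ?U1, ?U2, ?U3, ?U4, ?W1, ?W2,
  ?W3, ?W4, ?Y1, ?Y2, ?Y3, ?Y4.
repeat match goal with |- context [half_tan_quat ?a (T ?c)] =>
  let E1 := fresh in let E2 := fresh in let E3 := fresh in let E4 := fresh in
  destruct (half_tan_quat_axis (T c)) as (E1 & E2 & E3 & E4);
  first [rewrite E1 | rewrite E2 | rewrite E3 | rewrite E4]; clear E1 E2 E3 E4 end.
rewrite !qmul_one_r, !qmul_assoc; repeat split.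
Qed.

(** The product over the two sides has real part 1, so the i and j coordinates give a and b at once.
    The k coordinate says a b = - 2 X W, which becomes the quadratic relation. *)
Lemma degree4_vertex (X W a b : R) :
  is_scalar (qmul (qmul (Quat 1 a 0 0) (Quat 1 0 b 0))
                  (qmul (Quat 1 (- X) (- X) 0) (Quat 1 W (- W) 0))) <->
  degree4 X W a b.
Proof.
rewrite is_scalar_mul by (simpl; ring); unfold degree4; simpl; split.
- intros (H1 & H2 & H3).
  assert (Ea : a = X - W) by lra; assert (Eb : b = X + W) by lra.
  rewrite Ea, Eb in H3; repeat split; lra.
- intros (-> & -> & H); repeat split; lra.
Qed.

(** The half turn of the pattern carries [v2] to [v1]: directions change sign and the
    counterclockwise list now starts with the sides. *)
Lemma degree4_vertex_rotated (X W a b : R) :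
  is_scalar (qmul (qmul (Quat 1 X X 0) (Quat 1 (- W) W 0))
                  (qmul (Quat 1 (- a) 0 0) (Quat 1 0 (- b) 0))) <->
  degree4 X W a b.
Proof.
rewrite is_scalar_mul by (simpl; ring); unfold degree4; simpl; split.
- intros (H1 & H2 & H3).
  assert (Ea : a = X - W) by lra; assert (Eb : b = X + W) by lra.
  rewrite Ea, Eb in H3; repeat split; lra.
- intros (-> & -> & H); repeat split; lra.
Qed.

Lemma degree5_vertex (X Y z p q : R) :
  is_scalar (qmul (qmul (Quat 1 z 0 0) (Quat 1 X X 0))
         (qmul (qmul (Quat 1 0 p 0) (Quat 1 (- q) 0 0)) (Quat 1 Y (- Y) 0))) <->
  degree5 X Y z p q.
Proof.
set (P := qmul (Quat 1 0 p 0) (Quat 1 (- q) 0 0)).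
set (V := Quat 1 Y (- Y) 0).
(* The factors of z and then of X move cyclically to the end, so the ray product [P] comes first,
   followed by Y, z, X. *)
rewrite <- qmul_assoc, is_scalar_mul_comm, <- qmul_assoc, is_scalar_mul_comm
  by reflexivity.
rewrite <- !qmul_assoc, is_scalar_mul by (simpl; ring).
unfold degree5, real_part, P, V; simpl; split; intros (H1 & H2 & H3); repeat split; lra.
Qed.

Lemma degree5_vertex_rotated (X Y z p q : R) :
  is_scalar (qmul (qmul (Quat 1 q 0 0)
           (qmul (qmul (Quat 1 (- Y) Y 0) (Quat 1 (- z) 0 0))
                 (Quat 1 (- X) (- X) 0)))
         (Quat 1 0 (- p) 0)) <->
  degree5 X Y z p q.
Proof.
set (V := qmul (qmul (Quat 1 (- Y) Y 0) (Quat 1 (- z) 0 0)) (Quat 1 (- X) (- X) 0)).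
rewrite <- is_scalar_mul_comm by reflexivity.
rewrite qmul_assoc, is_scalar_mul by (simpl; ring).
unfold degree5, real_part, V; simpl; split; intros (H1 & H2 & H3); repeat split; lra.
Qed.

(** The half turn about the centre exchanges X with U and Y with W, so the conditions come in two
    pairs of equal shape. *)
Lemma configuration_space_iff (rho : folding) (X U W Y : R) :
  (forall c, - PI < rho c < PI) ->
  half_tan rho side32 = sqrt 2 * X -> half_tan rho side41 = sqrt 2 * U ->
  half_tan rho side24 = sqrt 2 * W -> half_tan rho side13 = sqrt 2 * Y ->
  (configuration_space rho <->
   degree4 U Y (half_tan rho ray1W) (half_tan rho ray1S) /\
   degree4 X W (half_tan rho ray2E) (half_tan rho ray2N) /\
   degree5 X Y (half_tan rho diagonal) (half_tan rho ray3N) (half_tan rho ray3W) /\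
   degree5 U W (half_tan rho diagonal) (half_tan rho ray4S) (half_tan rho ray4E)).
Proof.
intros Hrho EX EU EW EY.
destruct (half_tan_product_fan (half_tan rho) X U W Y EX EU EW EY)
  as (E1 & E2 & E3 & E4).
rewrite <- degree4_vertex_rotated, <- degree4_vertex, <- degree5_vertex,
  <- degree5_vertex_rotated, <- E1, <- E2, <- E3, <- E4.
rewrite <- !holonomy_scalar by exact Hrho.
unfold configuration_space, rigid_folding_state; split.
- intros [_ H]; repeat split; apply H.
- intros (H1 & H2 & H3 & H4); split; [exact Hrho | now intros []].
Qed.

(** * The four modes *)

(* At ray3N the vertex condition gives the half tangent
   (n - 1) t / (1 + 2 (n + 1) t^2), which is the tangent of
   atan ((1 + n) t) - atan (2 t); similarly at ray4S. *)
Definition mode (m n t : R) : folding := fun c =>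
  match c with
  | side32 | side41 => 2 * atan (sqrt 2 * t)
  | side24 => 2 * atan (sqrt 2 * m * t)
  | side13 => 2 * atan (sqrt 2 * n * t)
  | diagonal => 2 * atan (- 2 * t)
  | ray2E => 2 * atan ((1 - m) * t)
  | ray2N => 2 * atan ((1 + m) * t)
  | ray1W => 2 * atan ((1 - n) * t)
  | ray1S => 2 * atan ((1 + n) * t)
  | ray3W => 2 * atan ((n - 1) * t)
  | ray4E => 2 * atan ((m - 1) * t)
  | ray3N => 2 * atan ((1 + n) * t) - 2 * atan (2 * t)
  | ray4S => 2 * atan ((1 + m) * t) - 2 * atan (2 * t)
  end.

Lemma sqrt2_bounds : 1 < sqrt 2 < 3 / 2 /\ sqrt 2 * sqrt 2 = 2.
Proof.
assert (H : sqrt 2 * sqrt 2 = 2) by (apply sqrt_sqrt; lra).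
assert (H0 := sqrt_pos 2); repeat split; nra.
Qed.

Lemma half_tan_atan (x : R) : tan (2 * atan x / 2) = x.
Proof. replace (2 * atan x / 2) with (atan x) by field; apply tan_atan. Qed.

Lemma two_atan_bound (x : R) : - PI < 2 * atan x < PI.
Proof. assert (H := atan_bound x); lra. Qed.

Lemma two_atan_half_tan (r : R) : - PI < r < PI -> 2 * atan (tan (r / 2)) = r.
Proof. intros H; rewrite atan_tan; lra. Qed.

(** Both arctangents have the sign of t, so their difference does not leave the interval. This keeps
    the angles at [ray3N] and [ray4S] between -PI and PI. *)
Lemma atan_sub_bound (a b t : R) :
  0 < a -> 0 < b -> - (PI / 2) < atan (a * t) - atan (b * t) < PI / 2.
Proof.
intros Ha Hb.
assert (H1 := atan_bound (a * t)); assert (H2 := atan_bound (b * t)).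
assert (Hpos : forall k, 0 < k -> 0 <= t -> 0 <= atan (k * t)).
{ intros k Hk [Ht | <-]; [| rewrite Rmult_0_r, atan_0; lra].
  rewrite <- atan_0; left; apply atan_increasing; nra. }
assert (Hneg : forall k, 0 < k -> t <= 0 -> atan (k * t) <= 0).
{ intros k Hk [Ht | ->]; [| rewrite Rmult_0_r, atan_0; lra].
  rewrite <- atan_0; left; apply atan_increasing; nra. }
destruct (Rle_or_lt 0 t) as [Ht | Ht].
- assert (Ha' := Hpos a Ha Ht); assert (Hb' := Hpos b Hb Ht); lra.
- assert (Ha' := Hneg a Ha ltac:(lra)); assert (Hb' := Hneg b Hb ltac:(lra)); lra.
Qed.

Lemma half_tan_atan_sub (a b t : R) :
  0 < a -> 0 < b ->
  tan ((2 * atan (a * t) - 2 * atan (b * t)) / 2) * (1 + a * b * (t * t)) = (a - b) * t.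
Proof.
intros Ha Hb.
replace ((2 * atan (a * t) - 2 * atan (b * t)) / 2)
  with (atan (a * t) - atan (b * t)) by field.
assert (Hab : 0 < a * b) by nra.
assert (Hden : 0 < 1 + a * b * (t * t)) by (assert (0 <= t * t) by nra; nra).
rewrite tan_minus, !tan_atan.
- field; nra.
- apply Rgt_not_eq, cos_gt_0; assert (H := atan_bound (a * t)); lra.
- apply Rgt_not_eq, cos_gt_0; assert (H := atan_bound (b * t)); lra.
- apply Rgt_not_eq, cos_gt_0; apply atan_sub_bound; assumption.
- rewrite !tan_atan; nra.
Qed.

Lemma mode_bounds (m n t : R) (c : crease) :
  silver m -> silver n -> - PI < mode m n t c < PI.
Proof.
intros Hm Hn; apply silver_bounds in Hm, Hn.
assert (H1 := atan_sub_bound (1 + m) 2 t ltac:(lra) ltac:(lra)).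
assert (H2 := atan_sub_bound (1 + n) 2 t ltac:(lra) ltac:(lra)).
destruct c; simpl; try apply two_atan_bound; lra.
Qed.

Lemma mode_half_tan_sides (m n t : R) :
  half_tan (mode m n t) side32 = sqrt 2 * t /\
  half_tan (mode m n t) side41 = sqrt 2 * t /\
  half_tan (mode m n t) side24 = sqrt 2 * (m * t) /\
  half_tan (mode m n t) side13 = sqrt 2 * (n * t) /\
  half_tan (mode m n t) diagonal = - 2 * t.
Proof. unfold half_tan; simpl; rewrite !half_tan_atan; repeat split; ring. Qed.

(** Here [real_part] is 1 + 2 (1 + n) t^2, the denominator of the tangent subtraction formula for
    slopes 1 + n and 2. The remaining identities hold modulo the equation of n. *)
Lemma mode_degree5 (n t p : R) :
  silver n -> p * (1 + (1 + n) * 2 * (t * t)) = (1 + n - 2) * t ->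
  degree5 t (n * t) (- 2 * t) p ((n - 1) * t).
Proof.
unfold silver, degree5, real_part; intros Hn Hp.
assert (Hn3 : n * n - 2 * n - 1 = 0) by lra.
repeat split.
- transitivity (t + n * t + - 2 * t - 2 * t * (n * t) * (- 2 * t) +
    2 * (n * n - 2 * n - 1) * (t * t * t)); [ring | rewrite Hn3; ring].
- transitivity (p * (1 + (1 + n) * 2 * (t * t))); [ring | rewrite Hp; ring].
- transitivity (- ((n - 1) * t) * (p * (1 + (1 + n) * 2 * (t * t)))); [ring |].
  rewrite Hp.
  transitivity (- 2 * t * (t + n * t) + 2 * t * (n * t) -
    (n * n - 2 * n - 1) * (t * t)); [ring | rewrite Hn3; ring].
Qed.

Lemma mode_configuration (m n t : R) :
  silver m -> silver n -> configuration_space (mode m n t).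
Proof.
intros Hm Hn.
destruct (mode_half_tan_sides m n t) as (E1 & E2 & E3 & E4 & E5).
apply (configuration_space_iff (mode m n t) t t (m * t) (n * t)); auto.
{ intros c; now apply mode_bounds. }
rewrite E5; unfold half_tan; simpl; rewrite !half_tan_atan.
assert (Hm' := silver_bounds m Hm); assert (Hn' := silver_bounds n Hn).
split; [| split; [| split]].
- unfold silver in Hn; repeat split; try ring; nra.
- unfold silver in Hm; repeat split; try ring; nra.
- apply (mode_degree5 n t); [exact Hn |]; apply half_tan_atan_sub; lra.
- apply (mode_degree5 m t); [exact Hm |]; apply half_tan_atan_sub; lra.
Qed.

Lemma degree5_unique (X Y z p q p' q' : R) :
  real_part X Y z <> 0 -> degree5 X Y z p q -> degree5 X Y z p' q' ->
  p = p' /\ q = q'.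
Proof.
intros H (H1 & H2 & _) (H1' & H2' & _).
split; apply Rmult_eq_reg_r with (real_part X Y z); congruence.
Qed.

(** The rays at degree 4 vertices are linear in the sides. Those at degree 5 vertices are determined
    because the real part 1 + 2 (1 + k) t^2 is positive for k = m, n. The state and the mode solve
    the same system, hence agree. *)
Lemma sides_determine_mode (rho : folding) (m n t : R) :
  silver m -> silver n -> configuration_space rho ->
  half_tan rho side32 = sqrt 2 * t -> half_tan rho side41 = sqrt 2 * t ->
  half_tan rho side24 = sqrt 2 * (m * t) -> half_tan rho side13 = sqrt 2 * (n * t) ->
  half_tan rho diagonal = - 2 * t ->
  forall c, rho c = mode m n t c.
Proof.
intros Hm Hn Hrho E1 E2 E3 E4 E5.
assert (Hmode := mode_configuration m n t Hm Hn).
destruct (mode_half_tan_sides m n t) as (F1 & F2 & F3 & F4 & F5).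
assert (Hb := proj1 Hrho); assert (Hb' := proj1 Hmode).
apply (configuration_space_iff rho t t (m * t) (n * t)) in Hrho; auto.
apply (configuration_space_iff (mode m n t) t t (m * t) (n * t)) in Hmode; auto.
rewrite E5 in Hrho; rewrite F5 in Hmode.
destruct Hrho as ((A1 & A2 & _) & (B1 & B2 & _) & C1 & C2).
destruct Hmode as ((A1' & A2' & _) & (B1' & B2' & _) & C1' & C2').
assert (Hm' := silver_bounds m Hm); assert (Hn' := silver_bounds n Hn).
assert (Htt : 0 <= t * t) by nra.
assert (HA : forall k, - 1 / 2 < k -> real_part t (k * t) (- 2 * t) <> 0).
{ intros k Hk; unfold real_part; assert (0 <= (1 + k) * (t * t)) by nra; nra. }
assert (D1 := degree5_unique _ _ _ _ _ _ _ (HA n ltac:(lra)) C1 C1').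
assert (D2 := degree5_unique _ _ _ _ _ _ _ (HA m ltac:(lra)) C2 C2').
intros c; rewrite <- (two_atan_half_tan (rho c)), <- (two_atan_half_tan (mode m n t c))
  by auto.
enough (E : half_tan rho c = half_tan (mode m n t) c)
  by (unfold half_tan in E; now rewrite E).
clear Hb Hb'; destruct D1, D2, c; congruence.
Qed.

(** * Arctangent estimates and small folding states *)

Lemma atan_mean_value (x : R) : exists c, Rabs c <= Rabs x /\ atan x = x / (1 + c * c).
Proof.
destruct (MVT_gen atan 0 x (fun x => / (1 + x²))) as [c [Hc E]].
- intros; apply is_derive_atan.
- intros; apply derivable_continuous_pt, derivable_pt_atan.
- exists c; split.
  + revert Hc; unfold Rmin, Rmax, Rabs.
    destruct (Rle_dec 0 x), (Rcase_abs c), (Rcase_abs x); lra.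
  + rewrite atan_0 in E; unfold Rsqr in E; unfold Rdiv; lra.
Qed.

Lemma Rabs_atan_le (x : R) : Rabs (atan x) <= Rabs x.
Proof.
destruct (atan_mean_value x) as [c [_ ->]]; unfold Rdiv; rewrite Rabs_mult.
assert (Hc : 1 <= 1 + c * c) by nra.
rewrite (Rabs_pos_eq (/ _)) by (left; apply Rinv_0_lt_compat; lra).
assert (/ (1 + c * c) <= / 1) by (apply Rinv_le_contravar; lra).
rewrite Rinv_1 in H; assert (H0 := Rabs_pos x); nra.
Qed.

Lemma Rabs_atan_ge (x : R) : Rabs x <= 1 -> Rabs x <= 2 * Rabs (atan x).
Proof.
intros Hx; destruct (atan_mean_value x) as [c [Hc ->]].
unfold Rdiv; rewrite Rabs_mult.
assert (H0 := Rabs_pos x); assert (H1 := Rabs_pos c).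
assert (Hcc : 0 <= c * c <= 1).
{ split; [nra |]; rewrite <- (Rabs_pos_eq (c * c)), Rabs_mult by nra; nra. }
rewrite (Rabs_pos_eq (/ _)) by (left; apply Rinv_0_lt_compat; lra).
assert (/ 2 <= / (1 + c * c)) by (apply Rinv_le_contravar; lra).
nra.
Qed.

(** Since 2/5 <= |m| <= 3 and |atan y| lies between |y| / 2 and |y| for |y| <= 1, the constant 10 is
    ample. This supplies the comparability that [analytic_product_sign] asks for. *)
Lemma atan_comparable (m x : R) :
  silver m -> Rabs x < 1 / 10 ->
  Rabs (2 * atan (m * x)) <= 10 * Rabs (2 * atan x) /\
  Rabs (2 * atan x) <= 10 * Rabs (2 * atan (m * x)).
Proof.
intros Hm Hx; apply silver_bounds in Hm.
assert (Hma : 2 / 5 <= Rabs m <= 3) by (unfold Rabs; destruct (Rcase_abs m); nra).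
assert (H0 := Rabs_pos x).
assert (Hmx : Rabs (m * x) <= 3 * Rabs x) by (rewrite Rabs_mult; nra).
assert (Hmx' : 2 / 5 * Rabs x <= Rabs (m * x)) by (rewrite Rabs_mult; nra).
assert (H1 := Rabs_atan_le (m * x)); assert (H2 := Rabs_atan_le x).
assert (H3 := Rabs_atan_ge (m * x) ltac:(lra)).
assert (H4 := Rabs_atan_ge x ltac:(lra)).
rewrite !(Rabs_mult 2), !(Rabs_pos_eq 2) by lra; lra.
Qed.

Lemma atan_sign (x : R) : (0 < x -> 0 < atan x) /\ (x < 0 -> atan x < 0).
Proof. split; intros H; rewrite <- atan_0; now apply atan_increasing. Qed.

Lemma atan_product_sign (m x : R) :
  x <> 0 ->
  (0 < m -> 0 < 2 * atan (m * x) * (2 * atan x)) /\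
  (m < 0 -> 2 * atan (m * x) * (2 * atan x) < 0).
Proof.
intros Hx; destruct (atan_sign x) as [Hp Hn], (atan_sign (m * x)) as [Hp' Hn'].
destruct (Rtotal_order x 0) as [H | [H | H]]; [| lra |]; split; intros Hm.
- specialize (Hn H); specialize (Hn' ltac:(nra)); nra.
- specialize (Hn H); specialize (Hp' ltac:(nra)); nra.
- specialize (Hp H); specialize (Hp' ltac:(nra)); nra.
- specialize (Hp H); specialize (Hn' ltac:(nra)); nra.
Qed.

Lemma atan_injective (x y : R) : atan x = atan y -> x = y.
Proof. intros H; rewrite <- (tan_atan x), <- (tan_atan y); now f_equal. Qed.

Lemma half_tan_zero (r : R) : - PI < r < PI -> (tan (r / 2) = 0 <-> r = 0).
Proof.
intros H; split; intros E.
- rewrite <- (two_atan_half_tan r H), E, atan_0; ring.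
- rewrite E; unfold Rdiv; rewrite Rmult_0_l; apply tan_0.
Qed.

Lemma half_tan_small (r d : R) :
  0 < d -> Rabs r < 2 * atan d -> Rabs (tan (r / 2)) < d.
Proof.
intros Hd Hr; assert (Hb := atan_bound d).
apply Rabs_def2 in Hr; apply Rabs_def1.
- rewrite <- (tan_atan d) at 1; apply tan_increasing; lra.
- rewrite <- (tan_atan (- d)) at 1; rewrite atan_opp; apply tan_increasing; lra.
Qed.

(** The angle 2 atan (1/100) has half tangent 1/100, the smallness that [small_solutions] requires;
    division by sqrt 2 only decreases half tangents. *)
Lemma small_configuration_mode (rho : folding) :
  configuration_space rho ->
  Rabs (rho side32) < 2 * atan (1 / 100) ->
  Rabs (rho side41) < 2 * atan (1 / 100) ->
  Rabs (rho diagonal) < 2 * atan (1 / 100) ->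
  rho side32 <> 0 -> rho side41 <> 0 -> rho diagonal <> 0 ->
  exists m n t, silver m /\ silver n /\ t <> 0 /\ Rabs (sqrt 2 * t) < 1 / 10 /\
    forall c, rho c = mode m n t c.
Proof.
intros Hrho H1 H2 H3 Z1 Z2 Z3.
assert (Hb := proj1 Hrho).
apply half_tan_small in H1, H2, H3; try lra.
rewrite <- (half_tan_zero _ (Hb _)) in Z1.
rewrite <- (half_tan_zero _ (Hb _)) in Z2.
rewrite <- (half_tan_zero _ (Hb _)) in Z3.
change (tan (rho ?c / 2)) with (half_tan rho c) in *.
destruct sqrt2_bounds as [Hs Hss].
assert (E : forall c, half_tan rho c = sqrt 2 * (half_tan rho c / sqrt 2))
  by (intros; field; lra).
assert (Hsm : forall x, Rabs x < 1 / 100 -> Rabs (x / sqrt 2) < 1 / 100).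
{ intros x Hx; unfold Rdiv; rewrite Rabs_mult, (Rabs_pos_eq (/ sqrt 2))
    by (left; apply Rinv_0_lt_compat; lra).
  assert (/ sqrt 2 < / 1) by (apply Rinv_lt_contravar; lra).
  assert (0 < / sqrt 2) by (apply Rinv_0_lt_compat; lra).
  rewrite Rinv_1 in *; assert (Hx0 := Rabs_pos x); nra. }
assert (Hnz : forall x, x <> 0 -> x / sqrt 2 <> 0).
{ intros x Hx; apply Rmult_integral_contrapositive_currified; [exact Hx |].
  apply Rinv_neq_0_compat; lra. }
assert (Hc := Hrho).
apply (configuration_space_iff rho _ _ _ _ Hb (E _) (E _) (E _) (E _)) in Hc.
destruct Hc as ((_ & _ & HY) & (_ & _ & HW) & HF & HG).
apply degree5_quintic in HF, HG.
destruct (small_solutions _ _ _ _ _ (Hsm _ H1) (Hsm _ H2) H3 (Hnz _ Z1) (Hnz _ Z2) Z3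
  HW HY HF HG) as [EU Ez].
destruct (silver_roots _ _ HW) as [m [Hm EW]].
destruct (silver_roots _ _ HY) as [n [Hn EY]].
exists m, n, (half_tan rho side32 / sqrt 2).
repeat split; auto.
- rewrite <- E; lra.
- apply sides_determine_mode; auto.
  + now rewrite <- EU.
  + now rewrite <- EW.
  + now rewrite <- EU, <- EY.
Qed.

(** * Classification *)

Lemma mode_at_0 (m n : R) (c : crease) : mode m n 0 c = 0.
Proof. destruct c; simpl; rewrite !Rmult_0_r, !atan_0; ring. Qed.

Lemma two_atan_mul_injective (k s t : R) :
  k <> 0 -> 2 * atan (k * s) = 2 * atan (k * t) -> s = t.
Proof.
intros Hk H; apply Rmult_eq_reg_l with k; [| exact Hk].
apply atan_injective; lra.
Qed.

Lemma mode_rigid_folding_mode (m n : R) :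
  silver m -> silver n -> rigid_folding_mode (mode m n).
Proof.
intros Hm Hn; destruct sqrt2_bounds as [Hs _].
split; [| split; [| split]].
- apply mode_at_0.
- intros c; destruct c; simpl; try apply analytic_atan_linear;
  apply analytic_minus; apply analytic_atan_linear.
- exists 1; split; [lra |]; intros s t _ _ H.
  apply (two_atan_mul_injective (sqrt 2)); [lra | apply (H side32)].
- apply locally_0_iff; exists 1; split; [lra |]; intros t _.
  now apply mode_configuration.
Qed.

Lemma two_atan_linear_not_zero (k : R) :
  k <> 0 -> ~ identically_zero (fun t => 2 * atan (k * t)).
Proof.
intros Hk H; apply locally_0_iff in H; destruct H as [e [He H]].
assert (E := H (e / 2) ltac:(rewrite Rabs_pos_eq; lra)).
enough (e / 2 = 0) by lra; apply (two_atan_mul_injective k); [exact Hk |].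
now rewrite E, Rmult_0_r, atan_0, Rmult_0_r.
Qed.

Lemma mode_non_degenerate (m n : R) : non_degenerate (mode m n).
Proof.
destruct sqrt2_bounds as [Hs _]; split.
- assert (H := two_atan_linear_not_zero (sqrt 2) ltac:(lra)).
  intros []; [exists side41 | exists side32 | exists side32 | exists side41];
  eexists; (split; [simpl; eauto | exact H]).
- apply (two_atan_linear_not_zero (-2)); lra.
Qed.

(** The angle at [side32] does not depend on the ratios and determines the parameter. A single
    common point off the origin then reveals the ratios at [side24] and [side13]. *)
Lemma mode_germ_incl_ratios (m n m' n' : R) :
  germ_incl (mode m n) (mode m' n') -> m = m' /\ n = n'.
Proof.
intros H; destruct sqrt2_bounds as [Hs _].
destruct (H 1 ltac:(lra)) as [e [He Hincl]].
destruct (Hincl (e / 2) ltac:(rewrite Rabs_pos_eq; lra)) as [t [_ Ht]].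
assert (E : e / 2 = t).
{ apply (two_atan_mul_injective (sqrt 2)); [lra | apply (Ht side32)]. }
subst t; assert (E1 := Ht side24); assert (E2 := Ht side13); simpl in E1, E2.
assert (E1' := atan_injective _ _ (Rmult_eq_reg_l 2 _ _ E1 ltac:(lra))).
assert (E2' := atan_injective _ _ (Rmult_eq_reg_l 2 _ _ E2 ltac:(lra))).
assert (0 < sqrt 2 * (e / 2)) by nra.
split; apply Rmult_eq_reg_l with (sqrt 2 * (e / 2)); lra.
Qed.

(** X = 0 in the quadratic relation forces W = 0, and then both rays are flat. A mode that folds at
    [v1] and [v2] therefore moves [side41] and [side32]. *)
Lemma flat_side_flattens_degree4 (rho : folding) :
  configuration_space rho ->
  (rho side32 = 0 -> forall c theta, In (c, theta) (fan v2) -> rho c = 0) /\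
  (rho side41 = 0 -> forall c theta, In (c, theta) (fan v1) -> rho c = 0).
Proof.
intros Hrho; assert (Hb := proj1 Hrho).
destruct sqrt2_bounds as [Hs Hss].
assert (E : forall c, half_tan rho c = sqrt 2 * (half_tan rho c / sqrt 2))
  by (intros; field; lra).
apply (configuration_space_iff rho _ _ _ _ Hb (E _) (E _) (E _) (E _)) in Hrho.
assert (Hz : forall c, half_tan rho c = 0 -> rho c = 0)
  by (intros c; apply half_tan_zero, Hb).
assert (Hz' : forall c, rho c = 0 -> half_tan rho c / sqrt 2 = 0).
{ intros c Hc; apply (half_tan_zero _ (Hb c)) in Hc.
  unfold half_tan; rewrite Hc; field; lra. }
destruct Hrho as ((A1 & A2 & A3) & (B1 & B2 & B3) & _).
split; intros H0; apply Hz' in H0; intros c theta Hin; apply Hz.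
- rewrite H0 in *; assert (EW : half_tan rho side24 / sqrt 2 = 0) by nra.
  rewrite EW in *; simpl in Hin.
  destruct Hin as [F | [F | [F | [F | []]]]]; injection F as <- _.
  + lra.
  + lra.
  + rewrite E, H0; ring.
  + rewrite E, EW; ring.
- rewrite H0 in *; assert (EY : half_tan rho side13 / sqrt 2 = 0) by nra.
  rewrite EY in *; simpl in Hin.
  destruct Hin as [F | [F | [F | [F | []]]]]; injection F as <- _.
  + rewrite E, H0; ring.
  + rewrite E, EY; ring.
  + lra.
  + lra.
Qed.

Lemma folds_at_side (g : R -> folding) (v : vertex) (s : crease) :
  rigid_folding_mode g -> folds_at g v ->
  (forall rho, configuration_space rho -> rho s = 0 ->
     forall c theta, In (c, theta) (fan v) -> rho c = 0) ->
  ~ identically_zero (fun t => g t s).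
Proof.
intros (_ & _ & _ & Hg) (c & theta & Hin & Hc) Hflat Hs; apply Hc.
unfold identically_zero in *.
generalize (filter_and _ _ Hg Hs); apply filter_imp; intros t [H1 H2].
now apply (Hflat (g t) H1 H2 c theta).
Qed.

(** Continuity makes the angles small and isolated zeros make them nonzero, so each nearby state
    lies on one of the four curves. The ratios may still depend on t here. *)
Lemma mode_small_parametrization (g : R -> folding) :
  rigid_folding_mode g -> non_degenerate g ->
  locally 0 (fun t => t <> 0 -> exists m n x, silver m /\ silver n /\ x <> 0 /\
    Rabs (sqrt 2 * x) < 1 / 10 /\ forall c, g t c = mode m n x c).
Proof.
intros Hg [Hfold Hdiag]; assert (Hg' := Hg).
destruct Hg' as (g0 & Hana & _ & Hconf).
assert (N1 := folds_at_side g v2 side32 Hg (Hfold v2)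
  (fun rho H => proj1 (flat_side_flattens_degree4 rho H))).
assert (N2 := folds_at_side g v1 side41 Hg (Hfold v1)
  (fun rho H => proj2 (flat_side_flattens_degree4 rho H))).
assert (Hsmall : forall c, locally 0 (fun t => Rabs (g t c) < 2 * atan (1 / 100))).
{ intros c; apply continuity_pt_0_small; [| apply g0 |].
  - destruct (analytic_continuity _ (Hana c)) as [e [He H]]; apply H.
    rewrite Rabs_R0; exact He.
  - assert (H := proj1 (atan_sign (1 / 100)) ltac:(lra)); lra. }
generalize (filter_and _ _ Hconf (filter_and _ _
  (filter_and _ _ (Hsmall side32) (filter_and _ _ (Hsmall side41) (Hsmall diagonal)))
  (filter_and _ _ (analytic_isolated_zero _ (Hana side32) N1)
    (filter_and _ _ (analytic_isolated_zero _ (Hana side41) N2)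
                    (analytic_isolated_zero _ (Hana diagonal) Hdiag))))).
apply filter_imp; intros t (Hc & (S1 & S2 & S3) & Z1 & Z2 & Z3) Ht.
apply small_configuration_mode; auto.
Qed.

Lemma silver_root_of_sign (m : R) :
  silver m -> (0 < m -> m = 1 + sqrt 2) /\ (m < 0 -> m = 1 - sqrt 2).
Proof.
unfold silver; intros Hm; destruct sqrt2_bounds as [Hs Hss].
assert (E : (m - (1 + sqrt 2)) * (m - (1 - sqrt 2)) = 0) by nra.
apply Rmult_integral in E; split; intros H; destruct E; lra.
Qed.

(* The ratio of the half tangents of two creases is decided by the sign of the
   product of their folding angles. *)
Lemma silver_ratio_constant (f h : R -> R) :
  analytic_at_0 f -> analytic_at_0 h ->
  locally 0 (fun t => t <> 0 -> exists m x, silver m /\ x <> 0 /\ Rabs x < 1 / 10 /\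
    f t = 2 * atan (m * x) /\ h t = 2 * atan x) ->
  f 0 = 0 -> h 0 = 0 ->
  exists m0, (m0 = 1 + sqrt 2 \/ m0 = 1 - sqrt 2) /\
    locally 0 (fun t => t <> 0 -> forall m x, silver m -> x <> 0 ->
      f t = 2 * atan (m * x) -> h t = 2 * atan x -> m = m0).
Proof.
intros Hf Hh H f0 h0.
assert (Hsilver_neq : forall m, silver m -> m <> 0) by (unfold silver; intros m ? ->; lra).
assert (Hnz : locally 0 (fun t => t <> 0 -> f t <> 0 /\ h t <> 0)).
{ revert H; apply filter_imp; intros t H Ht.
  destruct (H Ht) as (m & x & Hm & Hx & _ & -> & ->).
  destruct (atan_product_sign m x Hx) as [Hp Hn].
  destruct (Rtotal_order m 0) as [L | [L | L]];
    [specialize (Hn L) | now apply Hsilver_neq in L | specialize (Hp L)];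
    split; intros E; rewrite E in *; lra. }
assert (Hnot : ~ identically_zero f /\ ~ identically_zero h).
{ apply locally_0_iff in Hnz; destruct Hnz as [e [He Hnz]]; split; intros Hz;
  apply locally_0_iff in Hz; destruct Hz as [e' [He' Hz]];
  set (t := Rmin e e' / 2);
  assert (Hmin : 0 < Rmin e e') by (now apply Rmin_pos);
  assert (Hm1 := Rmin_l e e'); assert (Hm2 := Rmin_r e e');
  assert (Ht : Rabs t = t) by (apply Rabs_pos_eq; unfold t; lra);
  destruct (Hnz t) as [N1 N2]; try (rewrite Ht; unfold t; lra);
  try (unfold t; lra); first [apply N1, Hz | apply N2, Hz]; rewrite Ht; unfold t; lra. }
assert (Hcmp : locally 0 (fun t => Rabs (f t) <= 10 * Rabs (h t) /\
                                   Rabs (h t) <= 10 * Rabs (f t))).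
{ revert H; apply filter_imp; intros t H.
  destruct (Req_dec t 0) as [-> | Ht]; [rewrite f0, h0, Rabs_R0; lra |].
  destruct (H Ht) as (m & x & Hm & _ & Hx & -> & ->); now apply atan_comparable. }
destruct (analytic_product_sign f h 10 Hf Hh (proj1 Hnot) (proj2 Hnot)) as [Hs | Hs].
- revert Hcmp; apply filter_imp; tauto.
- revert Hcmp; apply filter_imp; tauto.
- exists (1 + sqrt 2); split; [now left |]; revert Hs; apply filter_imp.
  intros t Hs Ht m x Hm Hx Ef Eh; specialize (Hs Ht); rewrite Ef, Eh in Hs.
  apply silver_root_of_sign; [exact Hm |].
  destruct (atan_product_sign m x Hx) as [_ Hn].
  destruct (Rtotal_order m 0) as [L | [L | L]]; auto.
  + specialize (Hn L); lra.
  + now apply Hsilver_neq in L.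
- exists (1 - sqrt 2); split; [now right |]; revert Hs; apply filter_imp.
  intros t Hs Ht m x Hm Hx Ef Eh; specialize (Hs Ht); rewrite Ef, Eh in Hs.
  apply silver_root_of_sign; [exact Hm |].
  destruct (atan_product_sign m x Hx) as [Hp _].
  destruct (Rtotal_order m 0) as [L | [L | L]]; auto.
  + now apply Hsilver_neq in L.
  + specialize (Hp L); lra.
Qed.

Lemma mode_same_ratios (g : R -> folding) :
  rigid_folding_mode g -> non_degenerate g ->
  exists m n, (m = 1 + sqrt 2 \/ m = 1 - sqrt 2) /\
    (n = 1 + sqrt 2 \/ n = 1 - sqrt 2) /\
    locally 0 (fun t => exists x, forall c, g t c = mode m n x c).
Proof.
intros Hg Hnd; assert (H := mode_small_parametrization g Hg Hnd).
destruct Hg as (g0 & Hana & _ & _); destruct sqrt2_bounds as [Hs _].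
assert (Hsx : forall x, x <> 0 -> sqrt 2 * x <> 0).
{ intros x Hx; apply Rmult_integral_contrapositive_currified; lra. }
destruct (silver_ratio_constant (fun t => g t side24) (fun t => g t side32))
  as [m0 [Hm0 Hm]]; auto.
{ revert H; apply filter_imp; intros t H Ht.
  destruct (H Ht) as (m & n & x & Sm & Sn & Hx & Hx' & E).
  exists m, (sqrt 2 * x); rewrite !E; simpl; repeat split; auto.
  do 2 f_equal; ring. }
destruct (silver_ratio_constant (fun t => g t side13) (fun t => g t side41))
  as [n0 [Hn0 Hn]]; auto.
{ revert H; apply filter_imp; intros t H Ht.
  destruct (H Ht) as (m & n & x & Sm & Sn & Hx & Hx' & E).
  exists n, (sqrt 2 * x); rewrite !E; simpl; repeat split; auto.
  do 2 f_equal; ring. }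
exists m0, n0; repeat split; auto.
generalize (filter_and _ _ H (filter_and _ _ Hm Hn)); apply filter_imp.
intros t (Ht & Hmt & Hnt); destruct (Req_dec t 0) as [-> | t0].
- exists 0; intros c; now rewrite mode_at_0.
- destruct (Ht t0) as (m & n & x & Sm & Sn & Hx & Hx' & E).
  exists x; intros c; rewrite E.
  rewrite (Hmt t0 m (sqrt 2 * x)), (Hnt t0 n (sqrt 2 * x)); auto;
    rewrite E; simpl; do 2 f_equal; ring.
Qed.

(** Continuity of the angle at [side32] keeps the parameter x small, which gives one inclusion. For
    the other, that angle covers a neighbourhood of 0 and determines the state. *)
Lemma same_mode_of_parametrization (g : R -> folding) (m n : R) :
  rigid_folding_mode g ->
  locally 0 (fun t => exists x, forall c, g t c = mode m n x c) ->
  same_mode g (mode m n).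
Proof.
intros (g0 & Hana & (e0 & He0 & Hinj) & _) H; destruct sqrt2_bounds as [Hs _].
apply locally_0_iff in H; destruct H as [e1 [He1 H]].
destruct (analytic_continuity _ (Hana side32)) as [e2 [He2 Hcont]].
split; intros d Hd.
- assert (Hsm : locally 0 (fun t => Rabs (g t side32) < 2 * atan d)).
  { apply continuity_pt_0_small; auto.
    - apply Hcont; rewrite Rabs_R0; exact He2.
    - assert (H0 := proj1 (atan_sign d) Hd); lra. }
  apply locally_0_iff in Hsm; destruct Hsm as [e3 [He3 Hsm]].
  exists (Rmin e1 e3); split; [now apply Rmin_pos |]; intros s Hlt.
  destruct (H s (Rlt_le_trans _ _ _ Hlt (Rmin_l _ _))) as [x Hx].
  exists x; split; [| exact Hx].
  specialize (Hsm s (Rlt_le_trans _ _ _ Hlt (Rmin_r _ _))).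
  rewrite Hx in Hsm; simpl in Hsm.
  apply half_tan_small in Hsm; [| exact Hd]; rewrite half_tan_atan in Hsm.
  rewrite Rabs_mult, (Rabs_pos_eq (sqrt 2)) in Hsm by lra.
  assert (H0 := Rabs_pos x); nra.
- set (e := Rmin (Rmin d e0) (Rmin e1 e2)).
  assert (He : 0 < e) by (repeat apply Rmin_pos; assumption).
  assert (Hle : e <= d /\ e <= e0 /\ e <= e1 /\ e <= e2).
  { assert (H1 := Rmin_l (Rmin d e0) (Rmin e1 e2)).
    assert (H2 := Rmin_r (Rmin d e0) (Rmin e1 e2)).
    assert (H3 := Rmin_l d e0); assert (H4 := Rmin_r d e0).
    assert (H5 := Rmin_l e1 e2); assert (H6 := Rmin_r e1 e2).
    fold e in H1, H2; lra. }
  destruct (continuous_injective_open_at_0 (fun t => g t side32) e) as [r [Hr Hopen]].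
  + exact He.
  + intros t Ht; apply Hcont; lra.
  + apply g0.
  (* Equal angles at [side32] give equal x, hence equal states, hence equal parameters by
     injectivity of the curve. *)
  + intros s t Hlts Hltt E.
    destruct (H s ltac:(lra)) as [x Hx], (H t ltac:(lra)) as [y Hy].
    apply Hinj; try lra; intros c.
    rewrite Hx, Hy in E; simpl in E.
    apply two_atan_mul_injective in E; [| lra]; now rewrite Hx, Hy, E.
  (* |2 atan (sqrt 2 s)| <= 2 sqrt 2 |s| < 3 (r / 4) < r. *)
  + exists (r / 4); split; [lra |]; intros s Hlts.
    destruct (Hopen (2 * atan (sqrt 2 * s))) as [t [Ht E]].
    { rewrite Rabs_mult, (Rabs_pos_eq 2) by lra.
      assert (H1 := Rabs_atan_le (sqrt 2 * s)).
      rewrite Rabs_mult, (Rabs_pos_eq (sqrt 2)) in H1 by lra.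
      assert (H2 := Rabs_pos s); nra. }
    exists t; split; [lra |]; intros c.
    destruct (H t ltac:(lra)) as [x Hx].
    rewrite Hx in E; simpl in E; apply two_atan_mul_injective in E; [| lra].
    now rewrite Hx, E.
Qed.

Theorem mainTheorem1 :
  exactly_up_to same_mode 4
    (fun g => rigid_folding_mode g /\ non_degenerate g).
Proof.
destruct sqrt2_bounds as [Hs Hss].
set (p := 1 + sqrt 2); set (q := 1 - sqrt 2).
assert (Sp : silver p) by (unfold silver, p; lra).
assert (Sq : silver q) by (unfold silver, q; lra).
assert (Hpq : p <> q) by (unfold p, q; lra).
(* The last clause serves index 3 and is a default value for larger indices. *)
exists (fun i => match i with
  | 0%nat => mode p p | 1%nat => mode p q | 2%nat => mode q p | _ => mode q q end).
split; [| split].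
- intros i _; destruct i as [| [| [| i]]];
  (split; [apply mode_rigid_folding_mode | apply mode_non_degenerate]); assumption.
- intros i j Hi Hj [Hincl _].
  destruct i as [| [| [| [| i]]]], j as [| [| [| [| j]]]]; try lia;
  apply mode_germ_incl_ratios in Hincl; destruct Hincl; exfalso; auto.
- intros g [Hg Hnd].
  destruct (mode_same_ratios g Hg Hnd) as (m & n & Hm & Hn & H).
  apply same_mode_of_parametrization in H; [| exact Hg].
  fold p q in Hm, Hn.
  destruct Hm as [-> | ->], Hn as [-> | ->];
    [exists 0%nat | exists 1%nat | exists 2%nat | exists 3%nat]; split; auto; lia.
Qed.
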